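(* Let $u\in\mathcal{O}_n$ be a unitary, let $z\in\mathcal{F}_n^1$ be a unitary, and set $\mathcal{A}=\lambda_z(\mathcal{D}_n)$. Then the following hold. (i) $\lambda_u(\mathcal{A})\subseteq\mathcal{A}$ if and only if $\lambda_{\lambda_{z^*}(u)}(\mathcal{D}_n)\subseteq\mathcal{D}_n$. In particular, if $\lambda_{z^*}(u)\in\mathcal{N}_{\mathcal{O}_n}(\mathcal{D}_n)$ then $\lambda_u(\mathcal{A})\subseteq\mathcal{A}$. (ii) $u\mathcal{A}u^*\subseteq\mathcal{A}$ if and only if $\lambda_{z^*}(u)\in\mathcal{N}_{\mathcal{O}_n}(\mathcal{D}_n)$.
   Context: Let $n\ge 2$ be an integer and let $\mathcal{O}_n$ be the Cuntz algebra, generated by isometries $S_1,\ldots,S_n$ with $\sum_{i=1}^n S_iS_i^*=I$. $\mathcal{F}_n^1=\operatorname{span}\{S_iS_j^*: i,j=1,\ldots,n\}\cong M_n(\mathbb{C})$. For a multi-index $\alpha=(\alpha_1,\ldots,\alpha_k)$ with entries in $\{1,\ldots,n\}$ put $S_\alpha=S_{\alpha_1}\cdots S_{\alpha_k}$; $\mathcal{D}_n$ is the $C^*$-subalgebra of $\mathcal{O}_n$ generated by all projections $S_\alpha S_\alpha^*$ (it is a maximal abelian subalgebra of $\mathcal{O}_n$). For a unitary $u\in\mathcal{O}_n$, $\lambda_u$ is the unital $*$-endomorphism of $\mathcal{O}_n$ determined by $\lambda_u(S_i)=uS_i$, $i=1,\ldots,n$; for a unitary $z\in\mathcal{F}_n^1$,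 $\lambda_z$ is an automorphism with inverse $\lambda_{z^*}$. The normalizer is $\mathcal{N}_{\mathcal{O}_n}(\mathcal{D}_n)=\{u\in\mathcal{O}_n \text{ unitary}: u\mathcal{D}_nu^*=\mathcal{D}_n\}$. *)

(* Defs.v *)
From HB Require Import structures.
From mathcomp Require Import all_boot all_order all_algebra.
From mathcomp Require Import all_classical all_reals all_analysis.
From mathcomp Require Import complex.
Set Implicit Arguments.
Unset Strict Implicit.
Unset Printing Implicit Defensive.
Import Order.TTheory GRing.Theory Num.Theory.
Import numFieldNormedType.Exports.
Local Open Scope classical_set_scope.
Local Open Scope ring_scope.

(** Nonzero unital complex C*-algebras.  The norm of a [normedModType R[i]]
    takes its values in [R[i]], so [`|x|] is a nonnegative complex number.
    The product is a plain field, with the algebra structure attached to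
    [cstar_sort] below: Hierarchy Builder rejects a structure that joins rings
    and normed modules, as [numDomainType] already joins rings and norms. *)

Record cstarAlgType (R : realType) := CStarAlg {
  cstar_carrier : completeNormedModType R[i];
  cstar_one : cstar_carrier;
  cstar_mul : cstar_carrier -> cstar_carrier -> cstar_carrier;
  cstar_star : cstar_carrier -> cstar_carrier;
  cstar_mulA : associative cstar_mul;
  cstar_mul1r : left_id cstar_one cstar_mul;
  cstar_mulr1 : right_id cstar_one cstar_mul;
  cstar_mulDl : left_distributive cstar_mul +%R;
  cstar_mulDr : right_distributive cstar_mul +%R;
  cstar_one_neq0 : cstar_one != 0;
  cstar_scaleAl : forall (a : R[i]) x y,
    a *: cstar_mul x y = cstar_mul (a *: x) y;
  cstar_scaleAr : forall (a : R[i]) x y,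
    a *: cstar_mul x y = cstar_mul x (a *: y);
  cstar_starK : involutive cstar_star;
  cstar_starD : {morph cstar_star : x y / x + y};
  cstar_starZ : forall (a : R[i]) x, cstar_star (a *: x) = a^* *: cstar_star x;
  cstar_starM : forall x y,
    cstar_star (cstar_mul x y) = cstar_mul (cstar_star y) (cstar_star x);
  cstar_normM : forall x y, `|cstar_mul x y| <= `|x| * `|y|;
  cstar_normV : forall x, `|cstar_mul (cstar_star x) x| = `|x| ^+ 2
}.

Definition cstar_sort (R : realType) (A : cstarAlgType R) : Type :=
  cstar_carrier A.
Coercion cstar_sort : cstarAlgType >-> Sortclass.

Section CStarTheory.
Variables (R : realType) (A : cstarAlgType R).

HB.instance Definition _ :=
  CompleteNormedModule.copy (cstar_sort A) (cstar_carrier A).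
HB.instance Definition _ := GRing.Zmodule_isNzRing.Build (cstar_sort A)
  (@cstar_mulA R A) (@cstar_mul1r R A) (@cstar_mulr1 R A)
  (@cstar_mulDl R A) (@cstar_mulDr R A) (@cstar_one_neq0 R A).
HB.instance Definition _ :=
  GRing.Lmodule_isLalgebra.Build R[i] (cstar_sort A) (@cstar_scaleAl R A).
HB.instance Definition _ :=
  GRing.Lalgebra_isAlgebra.Build R[i] (cstar_sort A) (@cstar_scaleAr R A).

Definition star : A -> A := @cstar_star R A.

Lemma starK : involutive star. Proof. exact: cstar_starK. Qed.
Lemma starD : {morph star : x y / x + y}. Proof. exact: cstar_starD. Qed.
Lemma starZ (a : R[i]) (x : A) : star (a *: x) = a^* *: star x.
Proof. exact: cstar_starZ. Qed.
Lemma starM (x y : A) : star (x * y) = star y * star x.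
Proof. exact: cstar_starM. Qed.
Lemma cstar_ler_normM (x y : A) : `|x * y| <= `|x| * `|y|.
Proof. exact: cstar_normM. Qed.
Lemma cstar_identity (x : A) : `|star x * x| = `|x| ^+ 2.
Proof. exact: cstar_normV. Qed.

End CStarTheory.

Definition unitary (R : realType) (A : cstarAlgType R) (u : A) : Prop :=
  star u * u = 1 /\ u * star u = 1.

(** No continuity is required: it is automatic for *-homomorphisms. *)
Definition unital_star_hom (R : realType) (A B : cstarAlgType R)
    (f : A -> B) : Prop :=
  [/\ linear f, monoid_morphism f & {morph f : x / star x}].

Definition cstar_subalgebra (R : realType) (A : cstarAlgType R)
    (M : set A) : Prop :=
  [/\ M 0,
      forall (a : R[i]) (x y : A), M x -> M y -> M (a *: x + y),
      forall x y : A, M x -> M y -> M (x * y),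
      forall x : A, M x -> M (star x) &
      closed M].

Definition generated_cstar (R : realType) (A : cstarAlgType R)
    (X : set A) : set A :=
  smallest (@cstar_subalgebra R A) X.

Section Cuntz.
Variables (R : realType) (n : nat).

(** For [i : 'I_n] the index is [i + 1] in the usual numbering [1, ..., n]. *)
Definition cuntz_relations (A : cstarAlgType R) (S : 'I_n -> A) : Prop :=
  (forall i, star (S i) * S i = 1) /\ \sum_(i < n) S i * star (S i) = 1.

(** [A] with the family [S] is the Cuntz algebra: the universal C*-algebra
    generated by [n] isometries whose range projections sum to [1]. *)
Definition is_cuntz_algebra (A : cstarAlgType R) (S : 'I_n -> A) : Prop :=
  [/\ cuntz_relations S,
      generated_cstar (range S) = setT &
      forall (B : cstarAlgType R) (T : 'I_n -> B), cuntz_relations T ->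
        exists2 f : A -> B, unital_star_hom f & forall i, f (S i) = T i].

Variables (A : cstarAlgType R) (S : 'I_n -> A).

Definition cuntz_word (alpha : seq 'I_n) : A := \prod_(i <- alpha) S i.

(** The span of the [S_i S_j^*]. *)
Definition cuntz_F1 : set A :=
  [set x | exists c : 'M[R[i]]_n,
     x = \sum_(i < n) \sum_(j < n) c i j *: (S i * star (S j))].

Definition cuntz_diag : set A :=
  generated_cstar
    (range (fun alpha => cuntz_word alpha * star (cuntz_word alpha))).

(** [lambda_u]; the default [idfun] is irrelevant for unitary [u], see
    [cuntz_endoP]. *)
Definition cuntz_endo (u : A) : A -> A :=
  match pselect (exists f : A -> A,
                   unital_star_hom f /\ forall i, f (S i) = u * S i) with
  | left f_ex => sval (cid f_ex)
  | right _ => idfun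
  end.

Definition conj_set (u : A) (X : set A) : set A :=
  [set u * x * star u | x in X].

Definition cuntz_diag_normalizer : set A :=
  [set u | unitary u /\ conj_set u cuntz_diag = cuntz_diag].

Lemma cuntz_endoP (u : A) : is_cuntz_algebra S -> unitary u ->
  unital_star_hom (cuntz_endo u) /\ forall i, cuntz_endo u (S i) = u * S i.
Proof.
move=> [[SK S1] _ univ] [uK uV].
have [f f_hom fS] : exists2 f : A -> A, unital_star_hom f
    & forall i, f (S i) = u * S i.
  apply: univ; split=> [i|].
    by rewrite starM mulrA -(mulrA _ (star u)) uK mulr1 SK.
  under eq_bigr => i _ do rewrite starM mulrA -(mulrA u).
  by rewrite -mulr_suml -mulr_sumr S1 mulr1.
rewrite /cuntz_endo.
by case: pselect => [f_ex|[]]; [exact: svalP (cid f_ex)|exists f].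
Qed.

End Cuntz.

(* Main.v *)
(** Write [D] for the diagonal.  Since [z] is in [F_n^1], [lambda_z] and
    [lambda_{z^*}] are mutually inverse, and [lambda_{z^*}] intertwines
    [lambda_u] with [lambda_w] and conjugation by [u] with conjugation by [w];
    uniqueness of the endomorphisms comes from contractivity of
    *-homomorphisms: if [t] is self-adjoint of norm [< 1], then [1 - t ^ 2] has
    a square root, so the image of [t] is the real part of a unitary.

    What remains in (ii) is that [w D w^* <= D] forces equality, which holds as
    [D] is maximal abelian.  For the latter, let [x] commute with [D], let [y]
    be a combination of words [S_a S_b^*] close to [x], and let [d] in [D] be
    the part of [y] with [a = b].  With [theta x = sum_i S_i x S_i^*] and the
    unbordered word [nu = 2 1 ... 1], the isometries [V_k = theta^k (S_nu)] have
    orthogonal ranges for neighbouring [k], so the normalized sum [X] of [N] of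
    them is an isometry, and it almost commutes with every [S_i] by telescoping.
    Hence [y - d] is close to [X^* (y - d) X]; on the other hand
    [X^* (x - d) X] is the mean of the [V_k^* (x - d) V_k], which are small:
    the range projection of [V_k] kills the terms with [|a| <> |b|], and the
    terms with [|a| = |b|], [a <> b] are removed by pinching with diagonal
    projections, which fixes [x - d]. *)
Require Import Defs.
From HB Require Import structures.
From mathcomp Require Import all_boot all_order all_algebra.
From mathcomp Require Import all_classical all_reals all_analysis.
From mathcomp Require Import complex.
From mathcomp Require Import ring lra zify.
Set Implicit Arguments.
Unset Strict Implicit.
Unset Printing Implicit Defensive.
Import Order.TTheory GRing.Theory Num.Theory.
Import numFieldNormedType.Exports.
Local Open Scope classical_set_scope.
Local Open Scope ring_scope.

(** * The norm as a real number *)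

Section CStarNorm.
Variables (R : realType) (A : cstarAlgType R).
Implicit Types (x y t : A) (c : R).

Definition nrm x : R := complex.Re `|x|.

Lemma nrmE x : `|x| = (nrm x)%:C%C.
Proof. by rewrite /nrm RRe_real ?normr_real. Qed.

Lemma nrm_ge0 x : 0 <= nrm x.
Proof. by rewrite -ler0c -nrmE. Qed.

Lemma nrm_eq0 x : nrm x = 0 -> x = 0.
Proof. by move=> x0; apply/normr0_eq0; rewrite nrmE x0. Qed.

Lemma nrm0 : nrm 0 = 0.
Proof. by rewrite /nrm normr0. Qed.

Lemma nrmD x y : nrm (x + y) <= nrm x + nrm y.
Proof. by rewrite -lecR rmorphD /= -!nrmE ler_normD. Qed.

Lemma nrmN x : nrm (- x) = nrm x.
Proof. by rewrite /nrm normrN. Qed.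

Lemma nrmB x y : nrm (x - y) <= nrm x + nrm y.
Proof. by rewrite -(nrmN y) nrmD. Qed.

Lemma nrm_dist x y : nrm (x - y) = nrm (y - x).
Proof. by rewrite -nrmN opprB. Qed.

Lemma nrmM x y : nrm (x * y) <= nrm x * nrm y.
Proof. by rewrite -lecR rmorphM /= -!nrmE cstar_ler_normM. Qed.

Lemma nrmZ (a : R[i]) x : nrm (a *: x) = complex.Re `|a| * nrm x.
Proof.
apply: (@complexI R); rewrite rmorphM -!nrmE normrZ; congr (_ * _).
exact/esym/RRe_real/normr_real.
Qed.

Lemma nrm_scale c x : nrm (c%:C%C *: x) = `|c| * nrm x.
Proof. by rewrite nrmZ normc_def /= expr0n addr0 sqrtr_sqr. Qed.

Lemma nrm_star_mul x : nrm (star x * x) = nrm x ^+ 2.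
Proof.
by apply: (@complexI R); rewrite rmorphXn /= -!nrmE cstar_identity.
Qed.

Lemma star0 : star (0 : A) = 0.
Proof. by rewrite -[in LHS](scale0r (0 : A)) starZ conjC0 scale0r. Qed.

Lemma starN x : star (- x) = - star x.
Proof. by apply/eqP; rewrite -subr_eq0 opprK -starD addNr star0. Qed.

Lemma starB x y : star (x - y) = star x - star y.
Proof. by rewrite starD starN. Qed.

Lemma star1 : star (1 : A) = 1.
Proof. by rewrite -[LHS]mul1r -[X in X * _](starK 1) -starM mul1r starK. Qed.

Lemma star_sum I (s : seq I) (P : pred I) (F : I -> A) :
  star (\sum_(i <- s | P i) F i) = \sum_(i <- s | P i) star (F i).
Proof. by apply: (big_morph _ (@starD R A)); rewrite star0. Qed.

Lemma star_scale c x : star (c%:C%C *: x) = c%:C%C *: star x.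
Proof. by rewrite starZ conj_Creal //; apply/complex_realP; exists c. Qed.

(** The C*-identity gives [nrm y ^+ 2 <= nrm (star y) * nrm y]. Cancelling [nrm y] yields one
    inequality, and applying it to [star x] yields the other. *)
Lemma nrm_star x : nrm (star x) = nrm x.
Proof.
suff le_star y : nrm y <= nrm (star y).
  by apply/eqP; rewrite eq_le le_star -[X in _ <= nrm X]starK le_star.
have [->|y0] := eqVneq (nrm y) 0; first exact: nrm_ge0.
have y_gt0 : 0 < nrm y by rewrite lt_def y0 nrm_ge0.
by rewrite -(ler_pM2r y_gt0) -expr2 -nrm_star_mul nrmM.
Qed.

Lemma nrm1 : nrm 1 = 1.
Proof.
have := nrm_star_mul 1; rewrite star1 mul1r expr2 => /eqP.
rewrite -subr_eq0 -{1}(mul1r (nrm 1)) -mulrBl mulf_eq0 => /orP[|/eqP/nrm_eq0].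
  by rewrite subr_eq0 => /eqP.
by move/eqP; rewrite oner_eq0.
Qed.

Lemma nrm_isometry x : star x * x = 1 -> nrm x = 1.
Proof.
move=> x1; have /eqP := nrm_star_mul x; rewrite x1 nrm1 eq_sym sqrf_eq1.
by case/orP => /eqP // x_eq; have := nrm_ge0 x; rewrite x_eq ler0N1.
Qed.

Lemma nrm_sa_sqr x : star x = x -> nrm (x * x) = nrm x ^+ 2.
Proof. by move=> xs; rewrite -{1}xs nrm_star_mul. Qed.

Lemma nrm_le_eps c x : (forall e : R, 0 < e -> nrm x <= c + e) -> nrm x <= c.
Proof. by move=> le_x; apply/ler_addgt0Pr. Qed.

Lemma closureP (M : set A) x :
  closure M x <-> forall e : R, 0 < e -> exists2 y, M y & nrm (x - y) < e.
Proof.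
split=> [Mx e e0|Mx].
  have [|y [My]] := Mx (ball x e%:C%C).
    by apply: nbhsx_ballx; rewrite ltcR.
  by rewrite -ball_normE /= nrmE ltcR => ?; exists y.
move=> B /nbhs_ballP[r /= r0 sub_B].
have r_real : r = (complex.Re r)%:C%C by rewrite RRe_real ?gtr0_real.
have [|y My xy] := Mx (complex.Re r); first by rewrite -ltcR -r_real.
exists y; split=> //; apply: sub_B.
by rewrite -ball_normE /= nrmE r_real ltcR.
Qed.

Lemma closedP (M : set A) :
  closed M <->
  forall x, (forall e : R, 0 < e -> exists2 y, M y & nrm (x - y) < e) -> M x.
Proof.
split=> [Mc x /closureP|Mc x /closureP]; [exact: Mc|exact: Mc].
Qed.

End CStarNorm.

Lemma closed_preimage (R : realType) (A B : cstarAlgType R) (f : A -> B)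
    (c : R) (M : set B) :
  (forall x y, nrm (f x - f y) <= c * nrm (x - y)) -> closed M ->
  closed [set x | M (f x)].
Proof.
move=> f_lip /closedP Mc; apply/closedP => x Mx; apply: Mc => e e0.
(* [|c| + 1] is positive whatever the sign of [c], and it is still a Lipschitz constant. *)
have c'0 : 0 < `|c| + 1 by rewrite ltr_wpDl.
have [|y My xy] := Mx (e / (`|c| + 1)); first by rewrite divr_gt0.
exists (f y) => //; apply: (le_lt_trans (f_lip _ _)).
rewrite ltr_pdivlMr // mulrC in xy; apply: le_lt_trans xy.
apply: ler_wpM2r; first exact: nrm_ge0.
by rewrite (le_trans (ler_norm c)) // lerDl.
Qed.

Lemma closed_zero_set (R : realType) (A B : cstarAlgType R) (f : A -> B)
    (c : R) :
  (forall x y, nrm (f x - f y) <= c * nrm (x - y)) ->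
  closed [set x | f x = 0].
Proof.
move=> f_lip; apply: (closed_preimage (M := [set 0]) f_lip).
apply/closedP => x x0; apply/nrm_eq0/eqP; rewrite eq_le nrm_ge0 andbT.
by apply: nrm_le_eps => e /x0[_ -> /ltW]; rewrite subr0 add0r.
Qed.

(** * Completeness and square roots near the identity *)

Section CStarComplete.
Variables (R : realType) (A : cstarAlgType R).
Implicit Types (x y t : A) (c : R).

Lemma nrm_cauchy_cvg (s : nat -> A) (q : R) : 0 <= q -> q < 1 ->
  (forall k, nrm (s k.+1 - s k) <= q ^+ k) ->
  exists l, forall e : R, 0 < e -> exists N, forall k, (N <= k)%N ->
    nrm (l - s k) < e.
Proof.
move=> q0 q1 s_q.
have q1' : 0 < 1 - q by rewrite subr_gt0.
(* The factor [1 - q ^+ m] makes this the exact geometric sum, so that the induction closes. *)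
have s_far k m : nrm (s (k + m)%N - s k) <= q ^+ k / (1 - q) * (1 - q ^+ m).
  elim: m => [|m IHm]; first by rewrite addn0 subrr nrm0 expr0 subrr mulr0.
  have -> : s (k + m.+1)%N - s k =
      (s (k + m).+1 - s (k + m)%N) + (s (k + m)%N - s k).
    by rewrite addnS addrA subrK.
  apply: le_trans (nrmD _ _) _; apply: le_trans (lerD (s_q _) IHm) _.
  rewrite le_eqVlt; apply/orP; left; apply/eqP.
  rewrite exprD exprS; field; exact: lt0r_neq0.
have s_far' k m : nrm (s (k + m)%N - s k) <= q ^+ k / (1 - q).
  apply: le_trans (s_far k m) _; rewrite ler_piMr //.
    by rewrite divr_ge0 ?exprn_ge0 // ltW.
  by rewrite gerBl exprn_ge0.
have q_small e : 0 < e ->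
    exists N, forall k, (N <= k)%N -> q ^+ k / (1 - q) < e.
  move=> e0; have q_lim : (fun k => q ^+ k) @ \oo --> (0 : R).
    by apply: cvg_expr; rewrite ger0_norm.
  have e1 : 0 < e * (1 - q) by rewrite mulr_gt0.
  have /cvgrPdist_lt/(_ _ e1)[N _ N_lt] := q_lim.
  exists N => k Nk; rewrite ltr_pdivrMr //; have := N_lt k Nk.
  by rewrite /= sub0r normrN ger0_norm // exprn_ge0.
have s_cvg : cvg (s @ \oo).
  apply: cauchy_cvg; apply: cauchy_exP => e e0.
  have e_real : e = (complex.Re e)%:C%C by rewrite RRe_real ?gtr0_real.
  have [|N N_lt] := q_small (complex.Re e); first by rewrite -ltcR -e_real.
  exists (s N); exists N => // k /= Nk; rewrite -ball_normE /= nrmE e_real ltcR.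
  rewrite nrm_dist -(subnKC Nk); exact: le_lt_trans (s_far' _ _) (N_lt _ _).
exists (lim (s @ \oo)) => e e0.
have /cvgrPdist_lt/(_ e%:C%C)[|N _ N_lt] := s_cvg; first by rewrite ltcR.
by exists N => k Nk; have := N_lt k Nk; rewrite /= nrmE ltcR.
Qed.

(* [1 - l] where [l] is the fixed point of the contraction
   [s |-> (t + s ^ 2) / 2]. *)
Lemma sqrt_one_minus t : star t = t -> nrm t < 1 ->
  exists b, [/\ star b = b, b * b = 1 - t &
                forall x, x * t = t * x -> x * b = b * x].
Proof.
move=> t_sa t1; set q := nrm t.
have q0 : 0 <= q by exact: nrm_ge0.
have half_real : (2^-1)%:C%C = 2^-1 :> R[i] by rewrite fmorphV rmorph_nat.
pose g s := (2^-1)%:C%C *: (t + s * s).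
pose s k := iter k g 0.
have nrm_half x : nrm ((2^-1)%:C%C *: x) = 2^-1 * nrm x.
  by rewrite nrm_scale ger0_norm // invr_ge0.
have s_bd k : nrm (s k) <= q.
  elim: k => [|k IHk]; first by rewrite nrm0.
  rewrite /s iterS -/(s k) /g nrm_half.
  have := nrmD t (s k * s k); have := nrmM (s k) (s k).
  have := nrm_ge0 (s k); rewrite -/q; nra.
(* On the ball of radius [q] the map [g] contracts by [q], since x^2 - y^2 = x (x - y) + (x - y)
   y. *)
have g_dist x y : nrm x <= q -> nrm y <= q ->
    nrm (g x - g y) <= q * nrm (x - y).
  move=> xq yq; rewrite /g -scalerBr nrm_half.
  have -> : t + x * x - (t + y * y) = x * (x - y) + (x - y) * y.
    by rewrite mulrBl mulrBr addrA subrK opprD addrACA subrr add0r.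
  have := nrmD (x * (x - y)) ((x - y) * y).
  have := nrmM x (x - y); have := nrmM (x - y) y.
  have := nrm_ge0 (x - y); nra.
have s_step k : nrm (s k.+1 - s k) <= q ^+ k.
  elim: k => [|k IHk].
    rewrite subr0 expr0; exact: le_trans (s_bd 1%N) (ltW t1).
  rewrite /s iterS -/(s k.+1) [X in _ - X]iterS -/(s k).
  apply: le_trans (g_dist _ _ (s_bd _) (s_bd _)) _.
  by rewrite exprS ler_wpM2l.
have [l s_l] := nrm_cauchy_cvg q0 t1 s_step.
(* Closed conditions that hold along the iteration pass to [l]; this gives both self-adjointness and
   the commutation property. *)
have close (M : set A) : closed M -> (forall k, M (s k)) -> M l.
  move=> /closedP Mc Ms; apply: Mc => e /s_l[N N_lt].
  by exists (s N) => //; apply: N_lt.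
have l_bd : nrm l <= q.
  apply: nrm_le_eps => e /s_l[N /(_ N (leqnn N)) N_lt].
  rewrite -(subrK (s N) l); have := nrmD (l - s N) (s N).
  have := s_bd N; lra.
have l_fix : l = g l.
  apply/eqP; rewrite -subr_eq0; apply/eqP/nrm_eq0/eqP.
  rewrite eq_le nrm_ge0 andbT; apply: nrm_le_eps => e e0; rewrite add0r.
  have e2 : 0 < e / 2 by rewrite divr_gt0.
  have [N N_lt] := s_l _ e2.
  have -> : l - g l = (l - s N.+1) + (g (s N) - g l) by rewrite addrA subrK.
  apply: le_trans (nrmD _ _) _.
  have := N_lt N.+1 (leqnSn N); have := N_lt N (leqnn N).
  have := g_dist (s N) l (s_bd N) l_bd; rewrite (nrm_dist (s N)).
  have := nrm_ge0 (l - s N); nra.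
have s_comm x k : x * t = t * x -> x * s k = s k * x.
  move=> xt; elim: k => [|k IHk]; first by rewrite mulr0 mul0r.
  rewrite /s iterS -/(s k) /g -scalerAr -scalerAl mulrDr mulrDl xt.
  by rewrite mulrA IHk -mulrA IHk mulrA.
have s_sa k : star (s k) = s k.
  elim: k => [|k IHk]; first by rewrite star0.
  by rewrite /s iterS -/(s k) /g star_scale starD starM IHk t_sa.
exists (1 - l); split.
- rewrite starB star1; congr (1 - _).
  apply: subr0_eq; apply: (close [set x | star x - x = 0]) => [|k].
    apply: (@closed_zero_set _ _ _ _ 2) => x y.
    have -> : star x - x - (star y - y) = star (x - y) - (x - y).
      by rewrite starB !opprB [y - star y]addrC addrACA [- x + y]addrC.
    by apply: le_trans (nrmB _ _) _; rewrite nrm_star mulr2n mulrDl mul1r.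
  by rewrite /= s_sa subrr.
(* The fixed-point equation 2 l = t + l^2 is a rearrangement of (1 - l)^2 = 1 - t. *)
- rewrite mulrBl mul1r mulrBr mulr1; set l2 := l * l.
  have : 2%:R *: l = t + l2.
    rewrite {1}l_fix /g scalerA half_real mulfV ?pnatr_eq0 // scale1r //.
  rewrite scaler_nat mulr2n => l2E.
  by rewrite opprB [l2 - l]addrC addrA -(addrA 1) -opprD l2E opprD addrA subrK.
- move=> x xt; rewrite mulrBl mulrBr mul1r mulr1; congr (_ - _).
  apply: subr0_eq; apply: (close [set y | x * y - y * x = 0]) => [|k].
    apply: (@closed_zero_set _ _ _ _ (2 * nrm x)) => y z.
    have -> : x * y - y * x - (x * z - z * x) = x * (y - z) - (y - z) * x.
      rewrite mulrBr mulrBl !opprB [z * x - x * z]addrC addrACA.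
      by rewrite [- (y * x) + _]addrC.
    have := nrmB (x * (y - z)) ((y - z) * x).
    have := nrmM x (y - z); have := nrmM (y - z) x; lra.
  by rewrite /= s_comm ?subrr.
Qed.

(** The element [u = b + 'i *: e] satisfies [star u * u = c], so its norm is the square root of [c],
    and [e] is its imaginary part. *)
Lemma sqr_sum_nrm (e b : A) (c : R) : star e = e -> star b = b ->
  e * b = b * e -> b * b + e * e = c%:C%C *: 1 -> 0 <= c -> nrm e ^+ 2 <= c.
Proof.
move=> e_sa b_sa eb bec c0; pose u := b + 'i *: e.
have uS : star u = b - 'i *: e by rewrite starD starZ conjCi e_sa b_sa scaleNr.
have uu : star u * u = c%:C%C *: 1.
  rewrite uS /u mulrBl !mulrDr -!scalerAr -!scalerAl scalerA eb.
  by rewrite -(expr2 'i) sqrCi scaleN1r opprD opprK addrA addrK.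
have u2 : nrm u ^+ 2 = c.
  by rewrite -nrm_star_mul uu nrm_scale nrm1 mulr1 ger0_norm.
suff eu : nrm e <= nrm u by rewrite -u2 lerXn2r ?nnegrE ?nrm_ge0.
have e2 : ('i + 'i) *: e = u - star u.
  by rewrite uS /u opprB [RHS]addrC addrA subrK scalerDl.
have : nrm (('i + 'i) *: e) = 2 * nrm e.
  rewrite (_ : 'i + 'i = 2%:R%:C%C * 'i); last by rewrite rmorph_nat mulr_natl.
  by rewrite -scalerA nrm_scale normr_nat nrmZ normCi mul1r.
by have := nrmB u (star u); rewrite nrm_star e2; lra.
Qed.

End CStarComplete.

(** * *-homomorphisms and generated subalgebras *)

Section StarHom.
Variables (R : realType) (A B : cstarAlgType R).

Section Props.
Variable f : A -> B.
Hypothesis f_hom : unital_star_hom f.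

Lemma homD x y : f (x + y) = f x + f y.
Proof. by case: f_hom => f_lin _ _; rewrite -[x]scale1r f_lin !scale1r. Qed.

Lemma hom0 : f 0 = 0.
Proof. by apply: (addrI (f 0)); rewrite -homD !addr0. Qed.

Lemma homZ (a : R[i]) x : f (a *: x) = a *: f x.
Proof.
by case: f_hom => f_lin _ _; rewrite -[a *: x]addr0 f_lin hom0 addr0.
Qed.

Lemma homB x y : f (x - y) = f x - f y.
Proof. by rewrite homD -scaleN1r homZ scaleN1r. Qed.

Lemma hom1 : f 1 = 1. Proof. by case: f_hom => _ []. Qed.

Lemma homM x y : f (x * y) = f x * f y.
Proof. by case: f_hom => _ []. Qed.

Lemma homS x : f (star x) = star (f x). Proof. by case: f_hom. Qed.

Lemma hom_sum I (s : seq I) (P : pred I) (F : I -> A) :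
  f (\sum_(i <- s | P i) F i) = \sum_(i <- s | P i) f (F i).
Proof. by apply: (big_morph _ homD hom0). Qed.

(* If [t] is self-adjoint with [nrm t < 1] then [1 - t ^ 2] is a square, so
   [f t] is the real part of a unitary. *)
Lemma hom_nrm x : nrm (f x) <= nrm x.
Proof.
have le1 t : star t = t -> nrm t < 1 -> nrm (f t) <= 1.
  move=> t_sa t1.
  have [||b [b_sa b2 b_comm]] := @sqrt_one_minus _ _ (t * t).
  - by rewrite starM t_sa.
  - by rewrite nrm_sa_sqr // expr_lt1 ?nrm_ge0.
  rewrite -(@ler_pXn2r _ 2) ?nnegrE ?nrm_ge0 // expr1n.
  apply: (@sqr_sum_nrm _ B (f t) (f b)) => //; rewrite -?homS ?t_sa ?b_sa //.
    by rewrite -!homM b_comm ?mulrA.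
  by rewrite -!homM -homD b2 subrK hom1 scale1r.
(* Dividing by [nrm t + e] brings the norm strictly below 1; then [e] tends to 0. *)
have le_sa t : star t = t -> nrm (f t) <= nrm t.
  move=> t_sa; apply: nrm_le_eps => e e0.
  have r0 : 0 < nrm t + e by rewrite ltr_wpDl // nrm_ge0.
  have ri0 : 0 <= (nrm t + e)^-1 by rewrite invr_ge0 ltW.
  have := le1 ((nrm t + e)^-1%:C%C *: t).
  rewrite star_scale t_sa homZ !nrm_scale ger0_norm //.
  rewrite ![_^-1 * _]mulrC ltr_pdivrMr // ler_pdivrMr // mul1r.
  have lt_te : nrm t < nrm t + e by rewrite ltrDl.
  by move=> le1t; exact: le1t erefl lt_te.
(* The C*-identity reduces a general [x] to the self-adjoint element [star x * x]. *)
rewrite -(@ler_pXn2r _ 2) ?nnegrE ?nrm_ge0 //.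
rewrite -!nrm_star_mul -homS -homM.
by apply: le_sa; rewrite starM starK.
Qed.

Lemma hom_lip x y : nrm (f x - f y) <= 1 * nrm (x - y).
Proof. by rewrite -homB mul1r hom_nrm. Qed.

End Props.
End StarHom.

(** * Generated C*-subalgebras and commutants *)

Section Generated.
Variables (R : realType) (A : cstarAlgType R).

Lemma generated_cstar_subalgebra (X : set A) :
  cstar_subalgebra (generated_cstar X).
Proof.
split; first by move=> M [[M0 _ _ _ _] _].
- move=> a x y Mx My M MX; have [_ ML _ _ _] := MX.1.
  by apply: ML; [exact: Mx|exact: My].
- move=> x y Mx My M MX; have [_ _ MM _ _] := MX.1.
  by apply: MM; [exact: Mx|exact: My].
- move=> x Mx M MX; have [_ _ _ MS _] := MX.1.
  by apply: MS; exact: Mx.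
- apply/closedP => x x_lim M MX; have [_ _ _ _ /closedP Mc] := MX.1.
  by apply: Mc => e /x_lim[y My xy]; exists y => //; exact: My.
Qed.

Section SubalgebraTheory.
Variable M : set A.
Hypothesis M_sub : cstar_subalgebra M.

Lemma subalg0 : M 0. Proof. by case: M_sub. Qed.

Lemma subalgZ (a : R[i]) x : M x -> M (a *: x).
Proof.
by case: M_sub => M0 ML _ _ _ Mx; rewrite -[_ *: _]addr0; apply: ML.
Qed.

Lemma subalgD x y : M x -> M y -> M (x + y).
Proof. by case: M_sub => _ ML _ _ _ Mx My; rewrite -[x]scale1r; apply: ML. Qed.

Lemma subalgB x y : M x -> M y -> M (x - y).
Proof.
by move=> Mx My; rewrite -scaleN1r; apply: subalgD => //; exact: subalgZ.
Qed.

Lemma subalg_sum I (s : seq I) (P : pred I) (F : I -> A) :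
  (forall i, P i -> M (F i)) -> M (\sum_(i <- s | P i) F i).
Proof. by apply: big_ind; [exact: subalg0|exact: subalgD]. Qed.

Lemma subalgM x y : M x -> M y -> M (x * y).
Proof. by case: M_sub => _ _ MM _ _; apply: MM. Qed.

Lemma subalgS x : M x -> M (star x).
Proof. by case: M_sub => _ _ _ MS _; apply: MS. Qed.

Lemma subalg_closed : closed M.
Proof. by case: M_sub. Qed.

End SubalgebraTheory.

(** Star-invariance of [X] makes the commutant star-invariant. Closedness holds because each
    commutator [y * x - x * y] is Lipschitz in [y]. *)
Lemma cstar_subalgebra_commutant (X : set A) : (forall x, X x -> X (star x)) ->
  cstar_subalgebra [set y : A | forall x, X x -> y * x = x * y].
Proof.
move=> XS; split=> /=.
- by move=> x _; rewrite mul0r mulr0.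
- by move=> a y z yX zX x Xx; rewrite mulrDl mulrDr -scalerAl -scalerAr yX ?zX.
- by move=> y z yX zX x Xx; rewrite -mulrA zX // mulrA yX // mulrA.
- by move=> y yX x Xx; rewrite -[x]starK -!starM yX //; exact: XS Xx.
- apply/closedP => y y_lim x Xx; apply: subr0_eq.
  have c_closed : closed [set y : A | y * x - x * y = 0].
    apply: (@closed_zero_set _ _ _ _ (2 * nrm x)) => u v.
    have -> : u * x - x * u - (v * x - x * v) = (u - v) * x - x * (u - v).
      rewrite mulrBr mulrBl !opprB [x * v - v * x]addrC addrACA.
      by rewrite [- (x * u) + _]addrC.
    have := nrmB ((u - v) * x) (x * (u - v)).
    have := nrmM x (u - v); have := nrmM (u - v) x; lra.
  move/closedP: c_closed; apply=> e /y_lim[z zX yz].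
  by exists z => //=; rewrite zX ?subrr.
Qed.

End Generated.

Lemma cstar_subalgebra_preim (R : realType) (A B : cstarAlgType R) (f : A -> B)
    (M : set B) :
  unital_star_hom f -> cstar_subalgebra M -> cstar_subalgebra [set x | M (f x)].
Proof.
move=> f_hom M_sub; split=> /=.
- by rewrite (hom0 f_hom); exact: subalg0 M_sub.
- move=> a x y Mx My; rewrite homD // homZ //.
  by apply: (subalgD M_sub) => //; exact: (subalgZ M_sub).
- by move=> x y Mx My; rewrite homM //; exact: (subalgM M_sub).
- by move=> x Mx; rewrite homS //; exact: (subalgS M_sub).
- by apply: closed_preimage (hom_lip f_hom) _; exact: (subalg_closed M_sub).
Qed.

(** The equalizer of [f] and [g] is a C*-subalgebra; its closedness comes from contractivity. *)
Lemma hom_ext (R : realType) (A B : cstarAlgType R) (f g : A -> B) (X : set A) :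
  generated_cstar X = setT -> unital_star_hom f -> unital_star_hom g ->
  (forall x, X x -> f x = g x) -> f =1 g.
Proof.
move=> genX f_hom g_hom fg x.
suff sub : generated_cstar X `<=` [set x | f x = g x].
  by apply: sub; rewrite genX.
apply: smallest_sub => //; split=> /=.
- by rewrite !hom0.
- by move=> a y z yE zE; rewrite !homD // !homZ // yE zE.
- by move=> y z yE zE; rewrite !homM // yE zE.
- by move=> y yE; rewrite !homS // yE.
- have c_closed : closed [set x | f x - g x = 0].
    apply: (@closed_zero_set _ _ _ _ 2) => y z.
    have -> : f y - g y - (f z - g z) = f (y - z) - g (y - z).
      rewrite (homB f_hom) (homB g_hom) !opprB [g z - f z]addrC addrACA.
      by rewrite [- g y + _]addrC.
    have := nrmB (f (y - z)) (g (y - z)).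
    have := hom_nrm f_hom (y - z); have := hom_nrm g_hom (y - z); lra.
  rewrite [X in closed X](_ : _ = [set x | f x - g x = 0]) //.
  by apply/seteqP; split=> y /=; [move->; rewrite subrr|move/subr0_eq].
Qed.

Lemma hom_comp (R : realType) (A B C : cstarAlgType R) (f : B -> C)
    (g : A -> B) :
  unital_star_hom f -> unital_star_hom g -> unital_star_hom (f \o g).
Proof.
move=> f_hom g_hom; split=> [a x y|| x] /=; last by rewrite !homS.
  by rewrite !homD // !homZ.
by split=> [|x y] /=; rewrite ?hom1 ?homM.
Qed.

Lemma hom_id (R : realType) (A : cstarAlgType R) : unital_star_hom (@idfun A).
Proof. by split. Qed.

(** * Projections with sum 1 are orthogonal *)

Section Positivity.
Variables (R : realType) (A : cstarAlgType R).
Implicit Types (x y t p q h : A) (c r : R).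

Lemma bernoulli c k : 0 <= c -> 1 + k%:R * c <= (1 + c) ^+ k.
Proof.
move=> c0; elim: k => [|k IHk]; first by rewrite mul0r addr0 expr0.
rewrite exprS -natr1; have k0 : 0 <= k%:R :> R by [].
nra.
Qed.

Lemma nrm_sum I (s : seq I) (P : pred I) (F : I -> A) :
  nrm (\sum_(i <- s | P i) F i) <= \sum_(i <- s | P i) nrm (F i).
Proof.
elim/big_ind2: _ => [|x a y b xa yb|//]; first by rewrite nrm0.
by apply: le_trans (nrmD _ _) (lerD xa yb).
Qed.

Definition projection p := star p = p /\ p * p = p.

Lemma projection_nrm p : projection p -> nrm p <= 1.
Proof.
move=> [p_sa pp]; have := nrm_sa_sqr p_sa; rewrite pp.
have := nrm_ge0 p; nra.
Qed.

Lemma projectionC p : projection p -> projection (1 - p).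
Proof.
move=> [p_sa pp]; split; first by rewrite starB star1 p_sa.
by rewrite mulrBr mulr1 mulrBl mul1r pp subrr subr0.
Qed.

(** Each use of the C*-identity doubles the exponent, so powers of two are reached; these suffice to
    detect exponential growth. *)
Lemma sa_expr_nrm x k : star x = x -> nrm (x ^+ (2 ^ k)) = nrm x ^+ (2 ^ k).
Proof.
move=> x_sa; elim: k => [|k IHk]; first by rewrite !expr1.
have sa_exp m : star (x ^+ m) = x ^+ m.
  elim: m => [|m IHm]; first by rewrite star1.
  by rewrite exprS starM IHm x_sa -exprSr exprS.
by rewrite expnS mulnC !exprM expr2 nrm_sa_sqr // IHk.
Qed.

(* [1 - p q p] is the block sum of [1 - p] and [y = p (1 - q) p], so its powers
   stay bounded by [2]. *)
Lemma nrm_compression p q : projection p -> projection q ->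
  nrm (1 - p * q * p) <= 1.
Proof.
move=> pP qP; have [p_sa pp] := pP.
pose y := p * (1 - q) * p; pose x := (1 - p) + y.
have -> : 1 - p * q * p = x.
  by rewrite /x /y mulrBr mulr1 mulrBl pp addrA subrK.
have p'y : (1 - p) * y = 0.
  by rewrite /y !mulrA mulrBl mul1r pp subrr !mul0r.
have yp' : y * (1 - p) = 0.
  by rewrite /y -!mulrA mulrBr mulr1 pp subrr !mulr0.
have p'p' : (1 - p) * (1 - p) = 1 - p by case: (projectionC pP).
have y1 : nrm y <= 1.
  have := nrmM (p * (1 - q)) p; have := nrmM p (1 - q).
  have := projection_nrm pP; have := projection_nrm (projectionC qP).
  rewrite -/y; have := nrm_ge0 p; have := nrm_ge0 (1 - q); nra.
have xm m : x ^+ m.+1 = (1 - p) + y ^+ m.+1.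
  elim: m => [|m IHm]; first by rewrite !expr1.
  rewrite exprS IHm /x (mulrDl (1 - p) y) (mulrDr (1 - p)) (mulrDr y) p'p'.
  by rewrite (exprS y m) (mulrA (1 - p)) p'y mul0r addr0 yp' add0r -!exprS.
have x_sa : star x = x.
  rewrite /x starD (projectionC pP).1 /y !starM p_sa (projectionC qP).1.
  by rewrite mulrA.
have xm2 m : nrm (x ^+ m.+1) <= 2.
  rewrite xm; have := nrmD (1 - p) (y ^+ m.+1).
  have := projection_nrm (projectionC pP).
  suff : nrm (y ^+ m.+1) <= 1 by lra.
  elim: m => [|m IHm]; first by rewrite expr1.
  rewrite exprS; have := nrmM y (y ^+ m.+1).
  have := nrm_ge0 y; have := nrm_ge0 (y ^+ m.+1); nra.
(* If [nrm x = 1 + d] with [d > 0], Bernoulli's inequality makes [nrm x ^+ (2 ^ k)] exceed 2 for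
   large [k], against the bound on the powers. *)
rewrite leNgt; apply/negP => x_gt1.
pose d := nrm x - 1; have d0 : 0 < d by rewrite subr_gt0.
have [k k_lt] : exists k : nat, d^-1 < k%:R.
  by exists (Num.truncn d^-1).+1; exact: truncnS_gt.
have k2 : (k <= 2 ^ k)%N by rewrite ltnW // ltn_expl.
have := xm2 (2 ^ k).-1; rewrite prednK ?expn_gt0 // sa_expr_nrm //.
rewrite -(subrK 1 (nrm x)) -/d addrC.
have := bernoulli (2 ^ k) (ltW d0).
have : 1 < (2 ^ k)%:R * d.
  rewrite -ltr_pdivrMr // div1r; apply: lt_le_trans k_lt _.
  by rewrite ler_nat.
lra.
Qed.

Lemma sqrt_sub t r : star t = t -> nrm t < r ->
  exists b, [/\ star b = b, b * b = r%:C%C *: 1 - t &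
                forall x, x * t = t * x -> x * b = b * x].
Proof.
move=> t_sa tr; have r0 : 0 < r by apply: le_lt_trans tr; exact: nrm_ge0.
have [||b [b_sa b2 b_comm]] := @sqrt_one_minus _ _ (r^-1%:C%C *: t).
- by rewrite star_scale t_sa.
- by rewrite nrm_scale ger0_norm ?invr_ge0 ?ltW // mulrC ltr_pdivrMr ?mul1r.
exists ((Num.sqrt r)%:C%C *: b); split.
- by rewrite star_scale b_sa.
- rewrite -scalerAl -scalerAr scalerA -rmorphM -expr2 sqr_sqrtr ?ltW //.
  by rewrite b2 scalerBr scalerA -rmorphM mulfV ?lt0r_neq0 // scale1r.
- by move=> x xt; rewrite -scalerAl -scalerAr b_comm // -scalerAl -scalerAr xt.
Qed.

(** The two norm bounds encode [h >= 0] and [h <= 0]. For each [d > 0] they give commuting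
    self-adjoint roots [a] of [d + h] and [b] of [d - h]. As a^2 + b^2 = 2 d, the norm of [d + h] is
    at most [2 * d], hence that of [h] at most [3 * d]. *)
Lemma positive_negative_eq0 h c : star h = h -> nrm (1 - h) <= 1 -> 0 <= c ->
  nrm (c%:C%C *: 1 + h) <= c -> h = 0.
Proof.
move=> h_sa h1 c0 hc; apply: nrm_eq0; apply/eqP; rewrite eq_le nrm_ge0 andbT.
apply: nrm_le_eps => e e0; rewrite add0r.
pose d := e / 3; have d0 : 0 < d by rewrite divr_gt0.
have [||a [a_sa a2 a_comm]] := @sqrt_sub (1 - h) (1 + d).
- by rewrite starB star1 h_sa.
- by apply: le_lt_trans h1 _; rewrite ltrDl.
have [||b [b_sa b2 b_comm]] := @sqrt_sub (c%:C%C *: 1 + h) (c + d).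
- by rewrite starD star_scale star1 h_sa.
- by apply: le_lt_trans hc _; rewrite ltrDl.
have a2' : a * a = d%:C%C *: 1 + h.
  by rewrite a2 rmorphD rmorph1 scalerDl scale1r opprB addrC addrA subrK addrC.
have b2' : b * b = d%:C%C *: 1 - h.
  by rewrite b2 rmorphD scalerDl opprD addrACA subrr add0r.
have ah : h * a = a * h.
  by apply: a_comm; rewrite mulrBl mulrBr mulr1 mul1r.
have ab : a * b = b * a.
  by apply: b_comm; rewrite mulrDl mulrDr -scalerAl -scalerAr mulr1 mul1r ah.
have := @sqr_sum_nrm _ _ a b (2 * d) a_sa b_sa ab.
rewrite -nrm_sa_sqr // a2' b2' => ab_sum.
have {ab_sum}hd : nrm (d%:C%C *: 1 + h) <= 2 * d.
  apply: ab_sum; last by rewrite mulr_ge0 // ltW.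
  rewrite [_ + h]addrC addrA subrK -scalerDl -rmorphD.
  by congr (real_complex _ _ *: _); ring.
rewrite -(addKr (d%:C%C *: 1) h) addrC.
have := nrmB (d%:C%C *: 1 + h) (d%:C%C *: 1).
rewrite nrm_scale nrm1 mulr1 (gtr0_norm d0).
move: hd; rewrite /d; lra.
Qed.

(** Compressing the sum by [p i] shows that the [h k] with [k != i] add up to 0. So [h j] is minus
    the sum of [m] compressions: it is both positive and negative, hence zero. The C*-identity for
    [p j * p i] then concludes. *)
Lemma projections_sum1_orthogonal n (p : 'I_n -> A) :
  (forall i, projection (p i)) -> \sum_i p i = 1 ->
  forall i j, i != j -> p i * p j = 0.
Proof.
move=> pP p_sum i j ij; pose h k := p i * p k * p i.
have h_sum : \sum_(k | (k != i) && (k != j)) h k = - h j.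
  have : \sum_k h k = p i.
    by rewrite /h -mulr_suml -mulr_sumr p_sum mulr1 (pP i).2.
  rewrite (bigD1 i) //= (bigD1 j) 1?eq_sym //= {1}/h (pP i).2 (pP i).2.
  move/eqP; rewrite -{2}[p i]addr0 (inj_eq (addrI _)) addrC addr_eq0.
  by move/eqP.
have h0 : h j = 0.
  pose m := #|[pred k | (k != i) && (k != j)]|.
  apply: (@positive_negative_eq0 _ m%:R).
  - by rewrite /h !starM (pP i).1 (pP j).1 mulrA.
  - exact: nrm_compression.
  - by [].
  have -> : m%:R%:C%C *: 1 + h j = \sum_(k | (k != i) && (k != j)) (1 - h k).
    by rewrite sumrB h_sum opprK sumr_const rmorph_nat scaler_nat.
  apply: le_trans (nrm_sum _ _ _) _.
  apply: le_trans (_ : \sum_(k | (k != i) && (k != j)) 1 <= _).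
    by apply: ler_sum => k _; exact: nrm_compression.
  by rewrite sumr_const.
rewrite -[LHS]starK -star0; congr star; apply: nrm_eq0; apply/eqP.
rewrite -sqrf_eq0 -nrm_star_mul starK starM (pP i).1 (pP j).1.
by rewrite -mulrA (mulrA (p j)) (pP j).2 mulrA -/(h j) h0 nrm0.
Qed.

End Positivity.

(** * Words, the diagonal and the canonical shift *)

Section CuntzRelations.
Variables (R : realType) (n : nat) (A : cstarAlgType R) (S : 'I_n -> A).
Hypothesis S_rel : cuntz_relations S.
Implicit Types (i j : 'I_n) (x y : A) (alpha beta : seq 'I_n).

Local Notation W := (cuntz_word S).
Local Notation proj alpha := (W alpha * star (W alpha)).
Local Notation D := (cuntz_diag S).

Lemma cuntz_isometry i : star (S i) * S i = 1.
Proof. by case: S_rel. Qed.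

(** The range projections sum to 1, so they are mutually orthogonal. *)
Lemma cuntz_orthogonal i j : i != j -> star (S i) * S j = 0.
Proof.
move=> ij; have [SK S1] := S_rel.
have orth : S i * star (S i) * (S j * star (S j)) = 0.
  apply: (projections_sum1_orthogonal (p := fun k => S k * star (S k))) => //.
  by move=> k; split; rewrite ?starM ?starK // mulrA -(mulrA (S k)) SK mulr1.
have -> : star (S i) * S j =
    star (S i) * (S i * star (S i) * (S j * star (S j))) * S j.
  by rewrite !mulrA SK mul1r -[RHS]mulrA SK mulr1.
by rewrite orth mulr0 mul0r.
Qed.

Lemma cuntz_word_cons i alpha : W (i :: alpha) = S i * W alpha.
Proof. by rewrite /cuntz_word big_cons. Qed.

Lemma cuntz_word_isometry alpha : star (W alpha) * W alpha = 1.
Proof.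
elim: alpha => [|i alpha IH]; first by rewrite /cuntz_word big_nil mulr1 star1.
rewrite cuntz_word_cons starM mulrA -(mulrA (star (W alpha))) cuntz_isometry.
by rewrite mulr1.
Qed.

Lemma proj_nil : proj [::] = 1.
Proof. by rewrite /cuntz_word big_nil mul1r star1. Qed.

Lemma proj_cons i alpha : proj (i :: alpha) = S i * proj alpha * star (S i).
Proof. by rewrite cuntz_word_cons starM !mulrA. Qed.

Lemma projP alpha : projection (proj alpha).
Proof.
split; first by rewrite starM starK.
by rewrite mulrA -(mulrA (W alpha)) cuntz_word_isometry mulr1.
Qed.

Lemma projC alpha beta : proj alpha * proj beta = proj beta * proj alpha.
Proof.
elim: alpha beta => [|i alpha IH] [|j beta];
  rewrite ?proj_nil ?mulr1 ?mul1r // !proj_cons.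
have conjM k l x y : S k * x * star (S k) * (S l * y * star (S l)) =
    S k * x * (star (S k) * S l) * y * star (S l) by rewrite !mulrA.
rewrite !conjM; have [<-|ij] := eqVneq i j.
  by rewrite cuntz_isometry !mulr1 -!(mulrA (S i)) IH.
have ji : j != i by rewrite eq_sym.
by rewrite (cuntz_orthogonal ij) (cuntz_orthogonal ji) !mulr0 !mul0r.
Qed.

Lemma diag_subalgebra : cstar_subalgebra D.
Proof. exact: generated_cstar_subalgebra. Qed.

Lemma proj_diag alpha : D (proj alpha).
Proof. by apply: sub_gen_smallest; exists alpha. Qed.

Lemma diag1 : D 1.
Proof. by rewrite -proj_nil; exact: proj_diag. Qed.

Lemma diag_ind (M : set A) : cstar_subalgebra M ->
  (forall alpha, M (proj alpha)) -> D `<=` M.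
Proof. by move=> M_sub Mp; apply: smallest_sub => // _ [alpha _ <-]. Qed.

(** Two passes through commutants: the generators commute with each other, so all of [D] commutes
    with the generators, so all of [D] commutes with [D]. *)
Lemma diagC x y : D x -> D y -> x * y = y * x.
Proof.
have DS z : D z -> D (star z) by exact: (subalgS diag_subalgebra).
have comm_proj z alpha : D z -> z * proj alpha = proj alpha * z.
  pose P := range (fun beta => proj beta).
  have sub : D `<=` [set z | forall p, P p -> z * p = p * z].
    apply: diag_ind => [|beta _ [gamma _ <-]]; last exact: projC.
    apply: cstar_subalgebra_commutant => _ [beta _ <-].
    by exists beta => //; case: (projP beta).
  by move=> Dz; apply: sub => //; exists alpha.
move=> Dx Dy; have sub := diag_ind (cstar_subalgebra_commutant DS).
by apply: (sub _ x) => // alpha z Dz; rewrite comm_proj.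
Qed.

Lemma cstar_subalgebra_conj (v : A) (M : set A) : star v * v = 1 ->
  cstar_subalgebra M -> cstar_subalgebra [set x | M (v * x * star v)].
Proof.
move=> vK M_sub; split=> /=.
- by rewrite mulr0 mul0r; exact: (subalg0 M_sub).
- move=> a x y Mx My; rewrite mulrDr mulrDl -scalerAr -scalerAl.
  by apply: (subalgD M_sub) => //; exact: (subalgZ M_sub).
- move=> x y Mx My; have := subalgM M_sub Mx My.
  by rewrite !mulrA -(mulrA _ (star v)) vK mulr1.
- by move=> x /(subalgS M_sub); rewrite !starM starK mulrA.
- apply: (@closed_preimage _ _ _ _ (nrm v * nrm v)) (subalg_closed M_sub).
  move=> x y; rewrite -mulrBl -mulrBr.
  have := nrmM (v * (x - y)) (star v); have := nrmM v (x - y).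
  rewrite nrm_star; have := nrm_ge0 v; nra.
Qed.

Lemma diag_conj i x : D x -> D (S i * x * star (S i)).
Proof.
have sub := diag_ind
  (cstar_subalgebra_conj (cuntz_isometry i) diag_subalgebra).
by apply: sub => alpha /=; rewrite -proj_cons; exact: proj_diag.
Qed.

(** Let [G] be the smallest closed subspace containing the words. The elements [b] such that [b] and
    [star b] both multiply [G] into itself form a C*-subalgebra [B] containing the generators, hence
    everything; applying them to [1] in [G] shows that [G] is the whole algebra. *)
Lemma cuntz_closed_span_ind (M : set A) : generated_cstar (range S) = setT ->
  M 0 -> (forall (a : R[i]) x y, M x -> M y -> M (a *: x + y)) -> closed M ->
  (forall alpha beta, M (W alpha * star (W beta))) -> forall x, M x.
Proof.
move=> S_gen M0 ML Mc MW x.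
pose lin (N : set A) := [/\ N 0,
  forall (a : R[i]) y z, N y -> N z -> N (a *: y + z), closed N &
  forall alpha beta, N (W alpha * star (W beta))].
pose G : set A := [set y | forall N, lin N -> N y].
have G_lin : lin G.
  split.
  - by move=> N [].
  - by move=> a y z Gy Gz N linN; have [_ NL _ _] := linN; apply: NL;
      [exact: Gy|exact: Gz].
  - apply/closedP => y y_lim N linN; have [_ _ /closedP Nc _] := linN.
    by apply: Nc => e /y_lim[z Gz yz]; exists z => //; exact: Gz.
  - by move=> alpha beta N [].
have [G0 GL Gc GW] := G_lin.
have mul_closed (b : A) (N : set A) :
    closed N -> closed [set y : A | N (b * y)].
  apply: (@closed_preimage _ _ _ _ (nrm b)) => y z.
  by rewrite -mulrBr; exact: nrmM.
have mul_closedr (b : A) (N : set A) :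
    closed N -> closed [set y : A | N (y * b)].
  apply: (@closed_preimage _ _ _ _ (nrm b)) => y z.
  by rewrite -mulrBl (mulrC (nrm b)) nrmM.
have star_closed (N : set A) : closed N -> closed [set y : A | N (star y)].
  apply: (@closed_preimage _ _ _ _ 1) => y z.
  by rewrite -starB nrm_star mul1r.
have lin_mul b : (forall alpha beta, G (b * (W alpha * star (W beta)))) ->
    forall y, G y -> G (b * y).
  move=> GbW y Gy; apply: (Gy [set y | G (b * y)]); split=> /=.
  - by rewrite mulr0.
  - by move=> a u v Gu Gv; rewrite mulrDr -scalerAr; exact: GL.
  - exact: mul_closed.
  - exact: GbW.
pose B : set A := [set b | forall y, G y -> G (b * y) /\ G (star b * y)].
have B_sub : cstar_subalgebra B.
  split=> /=.
  - by move=> y Gy; rewrite star0 mul0r.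
  - move=> a b c Bb Bc y Gy.
    have [by1 by2] := Bb y Gy; have [cy1 cy2] := Bc y Gy.
    by rewrite starD starZ !mulrDl -!scalerAl; split; exact: GL.
  - move=> b c Bb Bc y Gy; rewrite starM -!mulrA; split.
      by apply: (Bb _ _).1; exact: (Bc _ _).1.
    by apply: (Bc _ _).2; exact: (Bb _ _).2.
  - by move=> b Bb y Gy; rewrite starK; have [] := Bb y Gy.
  - apply/closedP => b b_lim y Gy; split.
      have /closedP := mul_closedr y G Gc; apply=> e /b_lim[c Bc bc].
      by exists c => //; case: (Bc y Gy).
    have /closedP := star_closed _ (mul_closedr y G Gc).
    apply=> e /b_lim[c Bc bc].
    by exists c => //; case: (Bc y Gy).
(* [S i] prepends a letter to [alpha]. Its adjoint cancels the first letter of [alpha] or gives 0,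
   and for empty [alpha] it appends a letter to [beta]. *)
have BS i : B (S i).
  move=> y Gy; split; apply: lin_mul Gy => -[|j alpha] beta.
  - by rewrite mulrA -cuntz_word_cons.
  - by rewrite mulrA -cuntz_word_cons.
  - have := GW [::] (rcons beta i).
    by rewrite /cuntz_word big_nil !mul1r big_rcons starM.
  - rewrite cuntz_word_cons !mulrA; have [<-|ij] := eqVneq i j.
      by rewrite cuntz_isometry mul1r.
    by rewrite cuntz_orthogonal // !mul0r.
have B1 : B x.
  suff : generated_cstar (range S) `<=` B by apply; rewrite S_gen.
  by apply: smallest_sub => // _ [i _ <-].
have := GW [::] [::]; rewrite proj_nil => /B1[+ _]; rewrite mulr1.
by apply; split.
Qed.

Definition cuntz_shift x := \sum_i S i * x * star (S i).
Local Notation theta := cuntz_shift.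
Local Notation th k := (iter k cuntz_shift).

Lemma shift_mulS x i : theta x * S i = S i * x.
Proof.
rewrite mulr_suml (bigD1 i) //= big1 => [|j ji].
  by rewrite -mulrA cuntz_isometry mulr1 addr0.
by rewrite -mulrA cuntz_orthogonal // mulr0.
Qed.

Lemma shift_Smul x i : star (S i) * theta x = x * star (S i).
Proof.
rewrite mulr_sumr (bigD1 i) //= big1 => [|j ji].
  by rewrite !mulrA cuntz_isometry mul1r addr0.
by rewrite !mulrA cuntz_orthogonal ?mul0r // eq_sym.
Qed.

Lemma shift1 : theta 1 = 1.
Proof.
by rewrite -[RHS](S_rel.2); apply: eq_bigr => i _; rewrite mulr1.
Qed.

Lemma shift0 : theta 0 = 0.
Proof. by rewrite /theta big1 // => i _; rewrite mulr0 mul0r. Qed.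

Lemma shiftM x y : theta (x * y) = theta x * theta y.
Proof.
rewrite {1 2}/theta mulr_suml; apply: eq_bigr => i _.
by rewrite -(mulrA _ _ (theta y)) shift_Smul !mulrA.
Qed.

Lemma shift_star x : theta (star x) = star (theta x).
Proof.
by rewrite star_sum; apply: eq_bigr => i _; rewrite !starM starK mulrA.
Qed.

Lemma shift_diag x : D x -> D (theta x).
Proof.
by move=> Dx; apply: (subalg_sum diag_subalgebra) => i _; exact: diag_conj.
Qed.

Lemma iter_shift1 k : th k 1 = 1.
Proof. by elim: k => //= k ->; rewrite shift1. Qed.

Lemma iter_shift0 k : th k 0 = 0.
Proof. by elim: k => //= k ->; rewrite shift0. Qed.

Lemma iter_shiftM k x y : th k (x * y) = th k x * th k y.
Proof. by elim: k => //= k ->; rewrite shiftM. Qed.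

Lemma iter_shift_star k x : th k (star x) = star (th k x).
Proof. by elim: k => //= k ->; rewrite shift_star. Qed.

Lemma iter_shift_diag k x : D x -> D (th k x).
Proof. by move=> Dx; elim: k => //= k; exact: shift_diag. Qed.

Lemma iter_shift_isometry k x : star x * x = 1 -> star (th k x) * th k x = 1.
Proof. by move=> xK; rewrite -iter_shift_star -iter_shiftM xK iter_shift1. Qed.

(** Each letter passed lowers the shift by one. Words of different lengths thus turn the same
    [th k x] into different shifts of [x]. *)
Lemma iter_shift_word alpha k x : (size alpha <= k)%N ->
  th k x * W alpha = W alpha * th (k - size alpha)%N x.
Proof.
elim: alpha k => [|i alpha IH] k /=.
  by rewrite /cuntz_word big_nil mulr1 mul1r subn0.
case: k => // k; rewrite ltnS subSS => le_k.
by rewrite cuntz_word_cons mulrA iterS shift_mulS -mulrA IH // mulrA.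
Qed.

Lemma iter_shift_star_word alpha k x : (size alpha <= k)%N ->
  star (W alpha) * th k x = th (k - size alpha)%N x * star (W alpha).
Proof.
move=> le_k; rewrite -[LHS]starK starM starK -iter_shift_star.
by rewrite iter_shift_word // starM -iter_shift_star starK.
Qed.

End CuntzRelations.

(** * The diagonal is maximal abelian *)

Section Pinching.
Variables (R : realType) (A : cstarAlgType R).
Implicit Types (x y p e : A).

Definition pinch p x := p * x * p + (1 - p) * x * (1 - p).

Lemma pinchD p (a : R[i]) x y :
  pinch p (a *: x + y) = a *: pinch p x + pinch p y.
Proof.
rewrite /pinch; move: (1 - p) => q; rewrite !mulrDr !mulrDl.
by rewrite -!scalerAr -!scalerAl scalerDr addrACA.
Qed.

(* [pinch p x] is the mean of [x] and [s x s] for the self-adjoint unitary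
   [s = p - (1 - p)]. *)
Lemma nrm_pinch p x : projection p -> nrm (pinch p x) <= nrm x.
Proof.
move=> pP; rewrite /pinch; have qP := projectionC pP.
have pq : p * (1 - p) = 0 by rewrite mulrBr mulr1 pP.2 subrr.
have qp : (1 - p) * p = 0 by rewrite mulrBl mul1r pP.2 subrr.
have p_q : p + (1 - p) = 1 by rewrite addrC subrK.
move: (1 - p) qP pq qp p_q => q qP pq qp p_q; pose s := p - q.
have s1 : nrm s = 1.
  apply: nrm_isometry; rewrite starB pP.1 qP.1 mulrBl !mulrBr pP.2 qP.2 pq qp.
  by rewrite subr0 sub0r opprK p_q.
have E : 2%:R%:C%C *: (p * x * p + q * x * q) = x + s * x * s.
  rewrite rmorph_nat scaler_nat mulr2n.
  have xE : x = p * x * p + q * x * q + (p * x * q + q * x * p).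
    rewrite -{1}[x]mul1r -{1}[x]mulr1 -p_q mulrA !(mulrDl, mulrDr).
    rewrite [p * x * q + q * x * q]addrC addrACA.
    by rewrite [q * x * p + p * x * q]addrC.
  have -> : s * x * s = p * x * p + q * x * q - (p * x * q + q * x * p).
    by rewrite /s !mulrBl !mulrBr opprB addrACA opprD.
  by rewrite [X in _ = X + _]xE [RHS]addrACA subrr addr0.
have := nrmD x (s * x * s); have := nrmM (s * x) s; have := nrmM s x.
rewrite -E nrm_scale s1 normr_nat; lra.
Qed.

Lemma pinch_fix p x : projection p -> x * p = p * x -> pinch p x = x.
Proof.
move=> pP xp; have xq : x * (1 - p) = (1 - p) * x.
  by rewrite mulrBr mulrBl mulr1 mul1r xp.
rewrite /pinch -xp -xq -!mulrA pP.2 (projectionC pP).2 -mulrDr.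
by rewrite addrC subrK mulr1.
Qed.

Lemma pinch_bimod p e e' x : e * p = p * e -> e' * p = p * e' ->
  e * pinch p x * e' = pinch p (e * x * e').
Proof.
move=> ep e'p.
have eq : e * (1 - p) = (1 - p) * e by rewrite mulrBr mulrBl mulr1 mul1r ep.
have e'q : e' * (1 - p) = (1 - p) * e' by rewrite mulrBr mulrBl mulr1 mul1r e'p.
by rewrite /pinch mulrDr mulrDl !mulrA ep eq -!mulrA e'p e'q.
Qed.

End Pinching.

(** * Iterated pinchings and shifted spike words *)

Section Spikes.
Variables (R : realType) (n : nat) (A : cstarAlgType R) (S : 'I_n -> A).
Hypothesis S_rel : cuntz_relations S.
Implicit Types (i j : 'I_n) (x y : A) (alpha beta : seq 'I_n).

Local Notation W := (cuntz_word S).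
Local Notation proj alpha := (W alpha * star (W alpha)).
Local Notation D := (cuntz_diag S).
Local Notation th k := (iter k (cuntz_shift S)).

Definition pinches (F : seq (seq 'I_n)) x :=
  foldr (fun alpha => pinch (proj alpha)) x F.

Lemma pinchesD F (a : R[i]) x y :
  pinches F (a *: x + y) = a *: pinches F x + pinches F y.
Proof. by elim: F => //= alpha F ->; rewrite pinchD. Qed.

Lemma pinches0 F : pinches F 0 = 0.
Proof.
by elim: F => //= alpha F ->; rewrite /pinch !mulr0 !mul0r addr0.
Qed.

Lemma pinchesB F x y : pinches F (x - y) = pinches F x - pinches F y.
Proof. by rewrite addrC -scaleN1r pinchesD scaleN1r addrC. Qed.

Lemma nrm_pinches F x : nrm (pinches F x) <= nrm x.
Proof.
elim: F => //= alpha F; apply: le_trans.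
exact: nrm_pinch (projP S_rel alpha).
Qed.

Lemma pinches_fix F x : (forall alpha, x * proj alpha = proj alpha * x) ->
  pinches F x = x.
Proof.
by move=> xp; elim: F => //= alpha F ->; rewrite pinch_fix //; exact: projP.
Qed.

Lemma pinches_bimod F e e' x : D e -> D e' ->
  e * pinches F x * e' = pinches F (e * x * e').
Proof.
move=> De De'; elim: F => //= alpha F <-.
by rewrite pinch_bimod //; apply: (diagC S_rel) => //; exact: proj_diag.
Qed.

(** The place of [alpha] in the list is immaterial: pinchings applied earlier are [D]-bimodule maps
    and so commute with this one, and those applied later preserve 0. *)
Lemma pinches_kill (F : seq (seq 'I_n)) alpha x :
  alpha \in F -> pinch (proj alpha) x = 0 ->
  pinches F x = 0.
Proof.
move=> + x0; have Dp : D (proj alpha) by exact: proj_diag.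
have Dq : D (1 - proj alpha).
  by apply: (subalgB (@diag_subalgebra _ _ _ S) _ Dp); exact: diag1.
elim: F => //= beta F IH; rewrite inE => /orP[/eqP <-|/IH ->]; last first.
  by rewrite /pinch !mulr0 !mul0r addr0.
rewrite {1}/pinch !pinches_bimod // -[pinches F (_ * x * _)]scale1r -pinchesD.
by rewrite scale1r -/(pinch _ _) x0 pinches0.
Qed.

Section SpikeWord.
Variables i0 i1 : 'I_n.
Hypothesis i01 : i0 != i1.

(** An unbordered word: its only [i1] comes first, so two translates at distance between 1 and [N]
    demand different letters at one position. *)
Definition spike N : seq 'I_n := i1 :: nseq N i0.
Local Notation Pk N k := (th k (proj (spike N))).
Local Notation Vk N k := (th k (W (spike N))).

(** At shift [k < N] the letter [i1] falls inside the run of [i0]; the induction strips the [k]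
    letters before the clash. *)
Lemma run_spike_orthogonal N k mu : (k < N)%N ->
  proj (nseq N i0) * th k (proj (i1 :: mu)) = 0.
Proof.
elim: N k => // N IH k kN; rewrite [nseq _ _]/= proj_cons.
rewrite -!mulrA; case: k kN => [|k] kN.
  by rewrite [th 0%N _]/= cuntz_word_cons !mulrA -(mulrA _ (star (S i0)))
    (cuntz_orthogonal S_rel i01) !(mulr0, mul0r).
rewrite iterS (shift_Smul S_rel) !mulrA -(mulrA (S i0)) -(mulrA (S i0)).
by rewrite IH // mulr0 mul0r.
Qed.

(** Stripping the leading [i1] leaves a run of [i0] and lowers the shift by one. *)
Lemma spike_shift_orthogonal N k : (0 < k <= N)%N ->
  proj (spike N) * Pk N k = 0.
Proof.
case: k => // k kN; have run := run_spike_orthogonal (nseq N i0) kN.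
rewrite iterS {1}/spike; move: run; rewrite -/(spike N).
move: (th k _) => y run; rewrite proj_cons -mulrA (shift_Smul S_rel).
by rewrite mulrA -(mulrA (S i1)) run mulr0 mul0r.
Qed.

Lemma spike_orthogonal N (j k : nat) :
  j != k -> (`|j - k| <= N)%N -> Pk N j * Pk N k = 0.
Proof.
have lt_case a b : (a < b)%N -> (b - a <= N)%N -> Pk N a * Pk N b = 0.
  move=> ab abN; rewrite -[b](subnKC (ltnW ab)) iterD -iter_shiftM //.
  by rewrite spike_shift_orthogonal ?subn_gt0 ?ab // iter_shift0.
have DP k' : D (Pk N k') by apply: (iter_shift_diag S_rel); exact: proj_diag.
rewrite neq_ltn => /orP[] jk dist_jk.
  by apply: lt_case => //; lia.
by rewrite (diagC S_rel) //; apply: lt_case => //; lia.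
Qed.

Lemma spike_diag N k : D (Pk N k).
Proof. by apply: (iter_shift_diag S_rel); exact: proj_diag. Qed.

Lemma spike_isometry N k : star (Vk N k) * Vk N k = 1.
Proof. exact/iter_shift_isometry/cuntz_word_isometry. Qed.

Lemma spike_range N k : Pk N k * Vk N k = Vk N k.
Proof. by rewrite -iter_shiftM // -mulrA cuntz_word_isometry // mulr1. Qed.

Lemma spike_star_range N k : star (Vk N k) * Pk N k = star (Vk N k).
Proof.
rewrite -iter_shift_star // -iter_shiftM // mulrA.
by rewrite cuntz_word_isometry // mul1r.
Qed.

Definition spike_sum N r := \sum_(0 <= k < N) Vk N (r + k)%N.

(** The cross terms vanish: [x] commutes with the range projections, and these are orthogonal since
    the [N] shifts differ by less than [N]. *)
Lemma spike_sum_compression N r x :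
  (forall k, x * Pk N k = Pk N k * x) ->
  star (spike_sum N r) * x * spike_sum N r =
  \sum_(0 <= k < N) star (Vk N (r + k)%N) * x * Vk N (r + k)%N.
Proof.
move=> xP; rewrite /spike_sum !big_mkord star_sum !mulr_suml.
apply: eq_bigr => k _; rewrite mulr_sumr (bigD1 k) //= big1 ?addr0 // => j jk.
rewrite -(spike_range N (r + j)) -(spike_star_range N (r + k)).
rewrite !mulrA -(mulrA _ _ x) -xP -!mulrA (mulrA (Pk N (r + k))).
rewrite spike_orthogonal ?mul0r ?mulr0 ?eqn_add2l 1?eq_sym //.
have := ltn_ord j; have := ltn_ord k; lia.
Qed.

Lemma spike_sum_norm N r : star (spike_sum N r) * spike_sum N r = N%:R.
Proof.
rewrite -[X in X * _]mulr1 spike_sum_compression => [|k]; last first.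
  by rewrite mulr1 mul1r.
under eq_bigr do rewrite mulr1 spike_isometry.
by rewrite sumr_const_nat subn0.
Qed.

End SpikeWord.
End Spikes.

(** * Almost central sums of shifts and maximality of the diagonal *)

Section Masa.
Variables (R : realType) (n : nat) (A : cstarAlgType R) (S : 'I_n -> A).
Hypothesis S_rel : cuntz_relations S.
Implicit Types (i j : 'I_n) (x y : A) (alpha beta : seq 'I_n).

Local Notation W := (cuntz_word S).
Local Notation proj alpha := (W alpha * star (W alpha)).
Local Notation D := (cuntz_diag S).
Local Notation th k := (iter k (cuntz_shift S)).

Lemma nrm_natmul k x : nrm (k%:R * x) = k%:R * nrm x.
Proof.
rewrite mulr_natl -scaler_nat -(rmorph_nat (real_complex R)) nrm_scale.
by rewrite normr_nat.
Qed.

Definition shift_sum (V : A) r N := \sum_(0 <= k < N) th (r + k)%N V.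

(** The bound [C] is uniform in [N], whereas a sum of [N] shifted spikes has norm the square root of
    [N]; after normalization the commutator tends to 0. The condition [0 < r] leaves one shift to
    spend on passing a generator. *)
Definition bounded_comm y := exists C : R, forall V r N,
  star V * V = 1 -> (0 < r)%N ->
  nrm (shift_sum V r N * y - y * shift_sum V r N) <= C.

Lemma shift_sum_telescope V r N :
  shift_sum V r.+1 N - shift_sum V r N = th (r + N)%N V - th r V.
Proof.
rewrite /shift_sum -sumrB.
rewrite (eq_bigr (fun k => th (r + k.+1)%N V - th (r + k)%N V)).
  by rewrite telescope_sumr // addn0.
by move=> k _; rewrite addnS addSn.
Qed.

Lemma shift_sum_telescope_nrm V r N : star V * V = 1 ->
  nrm (shift_sum V r.+1 N - shift_sum V r N) <= 2.
Proof.
move=> VK; rewrite shift_sum_telescope; apply: le_trans (nrmB _ _) _.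
by rewrite !nrm_isometry ?iter_shift_isometry.
Qed.

(** Moving [S i] across the sum lowers its starting shift by one. The two sums differ only in their
    end terms, both isometries, whence the constant 2. *)
Lemma bounded_commS i : bounded_comm (S i).
Proof.
exists 2 => V [//|r] N VK _.
have -> : shift_sum V r.+1 N * S i = S i * shift_sum V r N.
  rewrite mulr_suml mulr_sumr; apply: eq_bigr => k _.
  by rewrite addSn iterS shift_mulS.
rewrite -mulrBr; apply: le_trans (nrmM _ _) _; rewrite nrm_dist.
by rewrite nrm_isometry ?cuntz_isometry // mul1r shift_sum_telescope_nrm.
Qed.

Lemma bounded_comm_starS i : bounded_comm (star (S i)).
Proof.
exists 2 => V [//|r] N VK _.
have -> : star (S i) * shift_sum V r.+1 N = shift_sum V r N * star (S i).
  rewrite mulr_suml mulr_sumr; apply: eq_bigr => k _.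
  by rewrite addSn iterS shift_Smul.
rewrite -mulrBl; apply: le_trans (nrmM _ _) _.
rewrite nrm_star (nrm_isometry (cuntz_isometry S_rel i)) mulr1.
exact: shift_sum_telescope_nrm.
Qed.

Lemma bounded_comm1 : bounded_comm 1.
Proof. by exists 0 => V r N _ _; rewrite mulr1 mul1r subrr nrm0. Qed.

Lemma bounded_comm0 : bounded_comm 0.
Proof. by exists 0 => V r N _ _; rewrite mulr0 mul0r subrr nrm0. Qed.

Lemma bounded_commM x y :
  bounded_comm x -> bounded_comm y -> bounded_comm (x * y).
Proof.
move=> [C xC] [C' yC']; exists (C * nrm y + nrm x * C') => V r N VK r0.
move: (xC V r N VK r0) (yC' V r N VK r0); move: (shift_sum V r N) => X XxC XyC.
have -> : X * (x * y) - x * y * X = (X * x - x * X) * y + x * (X * y - y * X).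
  by rewrite mulrBl mulrBr !mulrA addrA subrK.
apply: le_trans (nrmD _ _) _; apply: lerD.
  by apply: le_trans (nrmM _ _) _; rewrite ler_wpM2r ?nrm_ge0.
by apply: le_trans (nrmM _ _) _; rewrite ler_wpM2l ?nrm_ge0.
Qed.

Lemma bounded_commD (a : R[i]) x y : bounded_comm x -> bounded_comm y ->
  bounded_comm (a *: x + y).
Proof.
move=> [C xC] [C' yC']; exists (complex.Re `|a| * C + C') => V r N VK r0.
move: (xC V r N VK r0) (yC' V r N VK r0); move: (shift_sum V r N) => X XxC XyC.
have -> : X * (a *: x + y) - (a *: x + y) * X =
    a *: (X * x - x * X) + (X * y - y * X).
  by rewrite mulrDr mulrDl -scalerAr -scalerAl opprD addrACA scalerBr.
apply: le_trans (nrmD _ _) _; rewrite nrmZ; apply: lerD => //.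
by rewrite ler_wpM2l // -ler0c RRe_real ?normr_real.
Qed.

Lemma bounded_comm_word alpha beta : bounded_comm (W alpha * star (W beta)).
Proof.
apply: bounded_commM.
  elim: alpha => [|i alpha IH].
    by rewrite /cuntz_word big_nil; exact: bounded_comm1.
  by rewrite cuntz_word_cons; apply: bounded_commM IH; exact: bounded_commS.
elim: beta => [|i beta IH].
  by rewrite /cuntz_word big_nil star1; exact: bounded_comm1.
rewrite cuntz_word_cons starM; apply: bounded_commM => //.
exact: bounded_comm_starS.
Qed.

Section SpikeWord.
Variables i0 i1 : 'I_n.
Hypothesis i01 : i0 != i1.
Local Notation spike := (spike i0 i1).
Local Notation Pk N k := (th k (proj (spike N))).
Local Notation Vk N k := (th k (W (spike N))).

(* [d] is the diagonal part of [y]; the remainder is killed by compressing to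
   far-out spikes after pinching by enough diagonal projections. *)
Definition almost_diagonal y :=
  exists d (F : seq (seq 'I_n)) L, [/\ D d, bounded_comm (y - d) &
  forall (G : seq (seq 'I_n)) N k, {subset F <= G} -> (L <= N)%N ->
    (L <= k)%N -> Pk N k * pinches S G (y - d) * Pk N k = 0].

Lemma almost_diagonalD (a : R[i]) x y :
  almost_diagonal x -> almost_diagonal y ->
  almost_diagonal (a *: x + y).
Proof.
move=> [d [F [L [Dd dC dP]]]] [d' [F' [L' [Dd' dC' dP']]]].
exists (a *: d + d'), (F ++ F'), (maxn L L').
have -> : a *: x + y - (a *: d + d') = a *: (x - d) + (y - d').
  by rewrite opprD addrACA scalerBr.
split; first by case: (@diag_subalgebra _ _ _ S) => _ DL _ _ _; exact: DL.
  exact: bounded_commD.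
move=> G N k FG; rewrite !geq_max => /andP[LN LN'] /andP[Lk Lk'].
rewrite pinchesD mulrDr mulrDl -scalerAr -scalerAl.
rewrite dP ?dP' ?scaler0 ?addr0 // => g gF; apply: FG; rewrite mem_cat gF //.
by rewrite orbT.
Qed.

Lemma almost_diagonal_diag x : D x -> almost_diagonal x.
Proof.
move=> Dx; exists x, [::], 0%N; split=> //; rewrite subrr.
  exact: bounded_comm0.
by move=> *; rewrite pinches0 mulr0 mul0r.
Qed.

Lemma word_orthogonal alpha beta : size alpha = size beta -> alpha != beta ->
  star (W alpha) * W beta = 0.
Proof.
elim: alpha beta => [|i alpha IH] [|j beta] //= [sz].
rewrite eqseq_cons negb_and !cuntz_word_cons starM mulrA.
rewrite -(mulrA _ (star (S i))).
have [<-|ij _] := eqVneq i j; last by rewrite cuntz_orthogonal // mulr0 mul0r.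
by rewrite cuntz_isometry // mulr1; exact: IH.
Qed.

(** Equal words give a diagonal element. Distinct words of equal length have orthogonal ranges, so
    pinching by [proj alpha] kills the product. For different lengths, moving the spike projections
    through the words gives two different shifts, which are orthogonal. *)
Lemma almost_diagonal_word alpha beta :
  almost_diagonal (W alpha * star (W beta)).
Proof.
have [<-|ab] := eqVneq alpha beta.
  by apply: almost_diagonal_diag; exact: proj_diag.
have bc := bounded_comm_word alpha beta.
have D0 : D 0 by exact: subalg0 (@diag_subalgebra _ _ _ S).
have [sz|sz] := eqVneq (size alpha) (size beta).
  exists 0, [:: alpha], 0%N; split; rewrite ?subr0 // => G N k aG _ _.
  rewrite (pinches_kill S_rel (alpha := alpha)) ?mulr0 ?mul0r //.
    by apply: aG; rewrite inE.
  rewrite /pinch; set b := star (W beta).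
  have bW : b * W alpha = 0.
    by rewrite word_orthogonal // 1?eq_sym.
  have -> : proj alpha * (W alpha * b) * proj alpha = 0.
    by rewrite -!mulrA (mulrA b) bW mul0r !mulr0.
  rewrite mulrBl mul1r !mulrA -(mulrA (W alpha) (star _)).
  by rewrite cuntz_word_isometry // mulr1 subrr mul0r addr0.
(* This [L] allows a shift [k >= L] to pass both words, and keeps the distance of the resulting
   shifts at most [N]. *)
pose L := maxn (size alpha) (size beta).
exists 0, [::], L; split; rewrite ?subr0 // => G N k _ LN Lk.
rewrite pinches_bimod //; try exact: spike_diag.
suff -> : Pk N k * (W alpha * star (W beta)) * Pk N k = 0 by rewrite pinches0.
rewrite -!mulrA iter_shift_star_word //; last first.
  exact: leq_trans (leq_maxr _ _) Lk.
rewrite mulrA iter_shift_word //; last exact: leq_trans (leq_maxl _ _) Lk.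
rewrite -mulrA (mulrA (th _ _)) spike_orthogonal ?mul0r ?mulr0 //.
  by move: Lk sz; rewrite /L; lia.
by move: Lk LN; rewrite /L; lia.
Qed.

Lemma almost_diagonal_dense x (e : R) : generated_cstar (range S) = setT ->
  0 < e -> exists2 y, almost_diagonal y & nrm (x - y) < e.
Proof.
move=> S_gen; move: e; apply/closureP; move: x.
have ad_closure y : almost_diagonal y -> closure almost_diagonal y.
  exact: subset_closure.
apply: (cuntz_closed_span_ind S_rel S_gen).
- apply: ad_closure; apply: almost_diagonal_diag.
  exact: subalg0 (@diag_subalgebra _ _ _ S).
- move=> a x y /closureP x_lim /closureP y_lim; apply/closureP => e e0.
  pose c := complex.Re `|a|.
  have c0 : 0 <= c by rewrite -ler0c RRe_real ?normr_real.
  have e1 : 0 < e / 2 / (c + 1) by rewrite !divr_gt0 // ltr_wpDl.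
  have [x' x'ad xx'] := x_lim _ e1.
  have [y' y'ad yy'] := y_lim (e / 2) ltac:(rewrite divr_gt0 //).
  exists (a *: x' + y'); first exact: almost_diagonalD.
  have -> : a *: x + y - (a *: x' + y') = a *: (x - x') + (y - y').
    by rewrite opprD addrACA scalerBr.
  apply: le_lt_trans (nrmD _ _) _; rewrite nrmZ -/c.
  move: xx'; rewrite ltr_pdivlMr ?ltr_wpDl // => xx'.
  have := nrm_ge0 (x - x'); nra.
- exact: closed_closure.
- by move=> alpha beta; apply: ad_closure; exact: almost_diagonal_word.
Qed.

Lemma diag_masa_spike x : generated_cstar (range S) = setT ->
  (forall d, D d -> x * d = d * x) -> D x.
Proof.
move=> S_gen xD; have Dsub := @diag_subalgebra _ _ _ S.
have /closedP := subalg_closed Dsub; apply=> e e0.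
(* The approximation error enters three times and the commutator contributes less than one more
   [e / 5], for a total below [e]. *)
have e5 : 0 < e / 5 by rewrite divr_gt0.
have [y [d [F [L [Dd [C dC] dP]]]] xy] := almost_diagonal_dense x S_gen e5.
exists d => //; pose h := x - d; pose y' := y - d.
have hD d' : D d' -> h * d' = d' * h.
  by move=> Dd'; rewrite mulrBl mulrBr xD // (diagC S_rel Dd).
have hy' : nrm (h - y') <= e / 5.
  by rewrite /h /y' opprB addrA subrK ltW.
(* With N = m^2 the norm of [X] is the integer [m], and [m > 5 * C / e] makes the commutator error
   [m * C] small against [N * e]. Starting the shifts at [N] puts all of them beyond [L]. *)
pose m := (maxn L (Num.truncn (5 * C / e)).+1).
pose N := (m ^ 2)%N; pose X := shift_sum (W (spike N)) N N.
have m_gt0 : (0 < m)%N by rewrite leq_max orbT.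
have Cm : 5 * C < m%:R * e.
  rewrite -ltr_pdivrMr //; apply: lt_le_trans (truncnS_gt _) _.
  by rewrite ler_nat leq_maxr.
have LN : (L <= N)%N.
  have : (L <= m)%N by exact: leq_maxl.
  by move=> /leq_trans; apply; rewrite /N -mulnn leq_pmull.
have XX : star X * X = N%:R by exact: spike_sum_norm.
have nX : nrm X = m%:R.
  apply/eqP; rewrite -(@eqrXn2 _ 2) ?nrm_ge0 ?ler0n //.
  by rewrite -nrm_star_mul XX -[N%:R]mulr1 nrm_natmul nrm1 mulr1 natrX.
have XhX : nrm (star X * h * X) <= N%:R * (e / 5).
  rewrite spike_sum_compression // => [|k]; last first.
    by rewrite hD //; exact: spike_diag.
  apply: le_trans (nrm_sum _ _ _) _.
  have -> : N%:R * (e / 5) = \sum_(0 <= k < N) e / 5.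
    by rewrite sumr_const_nat subn0 mulr_natl.
  apply: ler_sum => k _.
  have nV : nrm (Vk N (N + k)) = 1 by rewrite nrm_isometry ?spike_isometry.
  (* The pinchings fix [h], which commutes with [D], and the compression kills the pinched [y']; so
     [h] may be replaced by the pinched [h - y'], which is small. *)
  have -> : star (Vk N (N + k)) * h * Vk N (N + k) =
      star (Vk N (N + k)) * pinches S F (h - y') * Vk N (N + k).
    rewrite pinchesB [pinches S F h]pinches_fix // => [|alpha]; last first.
      by rewrite hD //; exact: proj_diag.
    have := dP F N (N + k)%N (fun _ => id) LN (leq_trans LN (leq_addr _ _)).
    move/(congr1 (fun z => star (Vk N (N + k)) * z * Vk N (N + k))).
    rewrite mulr0 mul0r !mulrA spike_star_range // -(mulrA _ (Pk _ _)).
    by rewrite spike_range // -/y' (mulrBr _ h) mulrBl => ->; rewrite subr0.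
  apply: le_trans (nrmM _ _) _; rewrite nV mulr1.
  apply: le_trans (nrmM _ _) _; rewrite nrm_star nV mul1r.
  exact: le_trans (nrm_pinches _ _ _) hy'.
(* Replace [h] by [y'], commute [y'] past [X], and return to [h]: two approximation errors, the
   compression of [h], and a commutator. *)
have split_mul (a b u v : A) : a * b * u = a * b * (u - v) + a * (v - u) * b +
    a * u * b + a * (b * v - v * b).
  rewrite -(addrA (a * b * (u - v))) -mulrDl -mulrDr subrK (mulrBr a) !mulrA.
  by rewrite -addrA (addrC (a * v * b)) subrK -mulrDr subrK.
have Nh := split_mul (star X) X h y'; rewrite XX in Nh.
have NE : N%:R = m%:R * m%:R :> R by rewrite -natrM mulnn.
have bound : N%:R * nrm h <= N%:R * (3 * (e / 5)) + m%:R * C.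
  rewrite -nrm_natmul Nh.
  have := nrmD (N%:R * (h - y') + star X * (y' - h) * X + star X * h * X)
    (star X * (X * y' - y' * X)).
  have := nrmD (N%:R * (h - y') + star X * (y' - h) * X) (star X * h * X).
  have := nrmD (N%:R * (h - y')) (star X * (y' - h) * X).
  have : nrm (N%:R * (h - y')) <= N%:R * (e / 5).
    by rewrite nrm_natmul ler_wpM2l.
  have : nrm (star X * (y' - h) * X) <= N%:R * (e / 5).
    apply: le_trans (nrmM _ _) _; rewrite NE nX mulrC -mulrA ler_wpM2l //.
    apply: le_trans (nrmM _ _) _; rewrite nrm_star nX ler_wpM2l //.
    by rewrite nrm_dist.
  have : nrm (star X * (X * y' - y' * X)) <= m%:R * C.
    apply: le_trans (nrmM _ _) _; rewrite nrm_star nX ler_wpM2l //.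
    apply: dC; last by rewrite /N expn_gt0 m_gt0.
    exact: cuntz_word_isometry.
  move: XhX; lra.
have m0 : 0 < m%:R :> R by rewrite ltr0n.
move: bound; rewrite NE -/h => bound.
have : m%:R * m%:R * nrm h < m%:R * m%:R * e by nra.
by rewrite ltr_pM2l ?mulr_gt0.
Qed.

End SpikeWord.
End Masa.

(** * Endomorphisms of the Cuntz algebra *)

Section CuntzAlgebra.
Variables (R : realType) (n : nat) (A : cstarAlgType R) (S : 'I_n -> A).
Hypothesis S_cuntz : is_cuntz_algebra S.
Implicit Types (u w x y z d : A).

Local Notation lambda := (cuntz_endo S).
Local Notation D := (cuntz_diag S).

Lemma cuntz_algebra_rel : cuntz_relations S.
Proof. by case: S_cuntz. Qed.

Lemma cuntz_algebra_gen : generated_cstar (range S) = setT.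
Proof. by case: S_cuntz. Qed.

Lemma diag_masa (n_ge2 : (2 <= n)%N) x :
  (forall d, D d -> x * d = d * x) -> D x.
Proof.
(* [n >= 2] supplies the two distinct letters of the spike. *)
apply: (diag_masa_spike cuntz_algebra_rel _ cuntz_algebra_gen
  (i0 := Ordinal (ltnW n_ge2)) (i1 := Ordinal n_ge2)).
by [].
Qed.

Lemma unitary_star u : unitary u -> unitary (star u).
Proof. by case=> uK uV; split; rewrite starK. Qed.

Lemma unitary_hom (f : A -> A) u : unital_star_hom f -> unitary u ->
  unitary (f u).
Proof.
by move=> f_hom [uK uV]; split; rewrite -homS // -homM // ?uK ?uV hom1.
Qed.

Lemma cuntz_hom_ext (f g : A -> A) : unital_star_hom f -> unital_star_hom g ->
  (forall i, f (S i) = g (S i)) -> f =1 g.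
Proof.
move=> f_hom g_hom fg; apply: (hom_ext cuntz_algebra_gen) => // _ [i _ <-].
exact: fg.
Qed.

Lemma endo_hom u : unitary u -> unital_star_hom (lambda u).
Proof. by move=> /(cuntz_endoP S_cuntz)[]. Qed.

Lemma endo_gen u i : unitary u -> lambda u (S i) = u * S i.
Proof. by move=> /(cuntz_endoP S_cuntz)[]. Qed.

(** On [S i * star (S j)] the endomorphism puts [u] on the left and [star u] on the right; linearity
    extends this to the span. *)
Lemma endo_F1 u z : unitary u -> cuntz_F1 S z -> lambda u z = u * z * star u.
Proof.
move=> uU [c ->]; have u_hom := endo_hom uU.
rewrite mulr_sumr mulr_suml (hom_sum u_hom); apply: eq_bigr => i _.
rewrite mulr_sumr mulr_suml (hom_sum u_hom); apply: eq_bigr => j _.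
rewrite (homZ u_hom) (homM u_hom) (homS u_hom) !endo_gen // starM.
by rewrite -scalerAr -scalerAl !mulrA.
Qed.

(** Induction on the word: prepending a letter [i] turns the image [p] into the conjugate by [w] of
    [S i * p * star (S i)], and both operations preserve [D]. *)
Lemma normalizer_endo_diag w : cuntz_diag_normalizer S w ->
  lambda w @` D `<=` D.
Proof.
move=> [wU wD] _ [x Dx <-]; have w_hom := endo_hom wU.
have D_sub := @diag_subalgebra _ _ _ S.
have sub := diag_ind (cstar_subalgebra_preim w_hom D_sub).
apply: sub Dx => alpha /=; elim: alpha => [|i alpha IH].
  by rewrite proj_nil (hom1 w_hom); exact: diag1.
rewrite proj_cons 2!(homM w_hom) (homS w_hom) endo_gen // starM.
rewrite -wD; exists (S i * lambda w (cuntz_word S alpha *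
  star (cuntz_word S alpha)) * star (S i)); last by rewrite !mulrA.
exact: (diag_conj cuntz_algebra_rel).
Qed.

(* If [w D w* <= D] then [w* D w] commutes with [D], so it lies in [D] by
   maximality. *)
Lemma conj_diag_normalizer (n_ge2 : (2 <= n)%N) w : unitary w ->
  conj_set w D `<=` D -> cuntz_diag_normalizer S w.
Proof.
move=> wU wD; split=> //; apply/seteqP; split=> // d Dd.
have [wK wV] := wU.
exists (star w * d * w); last by rewrite !mulrA wV mul1r -mulrA wV mulr1.
apply: diag_masa => // e De.
pose f := w * e * star w; have Df : D f by apply: wD; exists e.
have we : w * e = f * w by rewrite /f -mulrA wK mulr1.
have ew : e * star w = star w * f by rewrite /f !mulrA wK mul1r.
clearbody f; rewrite -mulrA we mulrA -(mulrA (star w)).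
by rewrite (diagC cuntz_algebra_rel Dd Df) !mulrA ew.
Qed.

End CuntzAlgebra.

Theorem proposition3p2 (R : realType) (n : nat) (n_ge2 : (2 <= n)%N)
    (O : cstarAlgType R) (S : 'I_n -> O) (O_cuntz : is_cuntz_algebra S)
    (u z : O) (u_unitary : unitary u)
    (z_unitary : unitary z) (z_F1 : cuntz_F1 S z) :
  let lambda := cuntz_endo S in
  let D := cuntz_diag S in
  let A := lambda z @` D in
  let w := lambda (star z) u in
  ((lambda u @` A `<=` A <-> lambda w @` D `<=` D) /\
   (cuntz_diag_normalizer S w -> lambda u @` A `<=` A)) /\
  (conj_set u A `<=` A <-> cuntz_diag_normalizer S w).
Proof.
move=> lambda D A w.
have z'_unitary := unitary_star z_unitary.
have z_hom : unital_star_hom (lambda z) by exact: endo_hom.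
have z'_hom : unital_star_hom (lambda (star z)) by exact: endo_hom.
have u_hom : unital_star_hom (lambda u) by exact: endo_hom.
have w_unitary : unitary w by exact: unitary_hom.
have w_hom : unital_star_hom (lambda w) by exact: endo_hom.
have [zK zV] := z_unitary; have [uK uV] := u_unitary.
have endoS v i : unitary v -> lambda v (S i) = v * S i by exact: endo_gen.
have endoF v y : unitary v -> cuntz_F1 S y -> lambda v y = v * y * star v.
  exact: endo_F1.
(* Checked on generators: as [z] lies in [cuntz_F1], [lambda (star z)] acts on it as conjugation by
   [star z] and so fixes it. *)
have z'z : cancel (lambda z) (lambda (star z)).
  apply: (cuntz_hom_ext O_cuntz (f := lambda (star z) \o lambda z)) => [||i].
  - exact: hom_comp.
  - exact: hom_id.
  rewrite /= endoS // (homM z'_hom) endoF // endoS // starK.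
  by rewrite zK mul1r mulrA zV mul1r.
have zz' : cancel (lambda (star z)) (lambda z).
  apply: (cuntz_hom_ext O_cuntz (f := lambda z \o lambda (star z))) => [||i].
  - exact: hom_comp.
  - exact: hom_id.
  rewrite /= endoS // (homM z_hom) (homS z_hom) endoF // endoS //.
  by rewrite -mulrA zV mulr1 mulrA zK mul1r.
have lambda_w x : lambda (star z) (lambda u (lambda z x)) = lambda w x.
  apply: (cuntz_hom_ext O_cuntz
    (f := lambda (star z) \o (lambda u \o lambda z))) => // [|i].
    by apply: hom_comp => //; exact: hom_comp.
  rewrite [LHS]/comp.
  (* Here [lambda u z = u * z * star u], and its factor [star u] cancels the [u] of
     [lambda u (S i)]. *)
  have -> : (lambda u \o lambda z) (S i) = u * lambda z (S i).
    rewrite /= endoS // (homM u_hom) endoF // endoS //.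
    by rewrite -!mulrA (mulrA (star u)) uK mul1r.
  by rewrite (homM z'_hom) z'z endoS.
have part1 : lambda u @` A `<=` A <-> lambda w @` D `<=` D.
  split=> sub t [x].
    move=> Dx <-; rewrite -lambda_w.
    have [|d Dd <-] := sub (lambda u (lambda z x)); last by rewrite z'z.
    by exists (lambda z x) => //; exists x.
  move=> [d Dd <-] <-; exists (lambda w d); first by apply: sub; exists d.
  by rewrite -lambda_w zz'.
split; first by split=> // w_norm; apply/part1; exact: normalizer_endo_diag.
have conj_w d : lambda (star z) (u * lambda z d * star u) = w * d * star w.
  by rewrite 2!(homM z'_hom) (homS z'_hom) z'z.
split=> [sub|[_ wD] _ [_ [d Dd <-] <-]].
  apply: conj_diag_normalizer => // _ [d Dd <-]; rewrite -conj_w.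
  have [|d' Dd' <-] := sub (u * lambda z d * star u); last by rewrite z'z.
  by exists (lambda z d) => //; exists d.
(* Applying [lambda z] to the intertwining relation [conj_w] exhibits the conjugate by [u] as the
   image of this element of [D]. *)
exists (w * d * star w); last by rewrite -conj_w zz'.
by rewrite /D -wD; exists d.
Qed.
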